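(* The triplet $\Omega=(\Omega^*,\Omega_+,\Omega_\bullet)$ of Burnside rings, with the maps $\Omega^*(\frac{\alpha}{\theta})$, $\Omega_+(\frac{\alpha}{\theta})$, $\Omega_\bullet(\frac{\alpha}{\theta})$ associated to 1-cells $\frac{\alpha}{\theta}$ of $\mathbb{S}$, satisfies the following. (i) $(\Omega^*,\Omega_+)$ is a Mackey functor on $\mathbb{S}$, and $(\Omega^*,\Omega_\bullet)$ is a semi-Mackey functor on $\mathbb{S}$. (ii) For any 1-cell $\frac{\alpha}{\theta}\colon\frac{X}{G}\to\frac{Y}{H}$ in $\mathbb{S}$ and any object $(A,\mathfrak{a})$ of ${}_G\mathrm{set}/X$, with associated partial exponential diagram consisting of $\frac{\mathfrak{a}}{G}\colon\frac{A}{G}\to\frac{X}{G}$, $\frac{\zeta}{G}\colon\frac{X\times_YP}{G}\to\frac{A}{G}$, $\frac{\alpha^\diamond}{\theta^\diamond}\colon\frac{X\times_YP}{G}\to\frac{P}{H}$ and $\frac{\pi_Y}{H}\colon\frac{P}{H}\to\frac{Y}{H}$, one has $$\Omega_\bullet\Big(\frac{\alpha}{\theta}\Big)\circ\Omega_+\Big(\frac{\mathfrak{a}}{G}\Big)=\Omega_+\Big(\frac{\pi_Y}{H}\Big)\circ\Omega_\bullet\Big(\frac{\alpha^\diamond}{\theta^\diamond}\Big)\circ\Omega^*\Big(\frac{\zeta}{G}\Big)$$ as maps $\Omega(\frac{A}{G})\to\Omega(\frac{Y}{H})$.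
   Context: For a finite group $G$, ${}_G\mathrm{set}$ is the category of finite $G$-sets and $G$-maps; objects of the slice category ${}_G\mathrm{set}/X$ are written $(A,\mathfrak{a})$ with $\mathfrak{a}\colon A\to X$ a $G$-map. The unit of a group is denoted $e$. The strict 2-category $\mathbb{S}$. A 0-cell is a pair of a finite group $G$ and a finite $G$-set $X$, denoted $\frac{X}{G}$ (a formal symbol). A 1-cell $\frac{\alpha}{\theta}\colon\frac{X}{G}\to\frac{Y}{H}$ is a pair of a map $\alpha\colon X\to Y$ and a family of maps $\theta=\{\theta_x\colon G\to H\}_{x\in X}$ with $\alpha(gx)=\theta_x(g)\alpha(x)$ and $\theta_x(gg')=\theta_{g'x}(g)\theta_x(g')$ for all $x\in X$, $g,g'\in G$. Composition: $\frac{\beta}{\tau}\circ\frac{\alpha}{\theta}=\frac{\beta\circ\alpha}{\tau\circ\theta}$, where $(\tau\circ\theta)_x=\tau_{\alpha(x)}\circ\theta_x$. For a $G$-map $\alpha$, $\frac{\alpha}{G}$ is the 1-cell with $\theta_x=\mathrm{id}_G$ for all $x$. A 2-cell $\varepsilon\colon\frac{\alpha}{\theta}\Rightarrow\frac{\alpha'}{\theta'}$ between 1-cells $\frac{X}{G}\to\frac{Y}{H}$ is a family $\{\varepsilon_x\in H\}_{x\in X}$ with $\alpha'(x)=\varepsilon_x\alpha(x)$ and $\varepsilon_{gx}\theta_x(g)\varepsilon_x^{-1}=\theta'_x(g)$ for all $x\in X,g\in G$. Vertical composition: $(\varepsilon'\cdot\varepsilon)_x=\varepsilon'_x\varepsilon_x$;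 all 2-cells are invertible. Whiskering: $(\frac{\beta}{\tau}\circ\varepsilon)_x=\tau_{\alpha(x)}(\varepsilon_x)$ and $(\delta\circ\frac{\alpha}{\theta})_x=\delta_{\alpha(x)}$. Bicoproduct. A bicoproduct of 0-cells $A_1,A_2$ is a 0-cell $A_1\amalg A_2$ with 1-cells $\iota_i\colon A_i\to A_1\amalg A_2$ ($i=1,2$) such that: (i) for any 0-cell $Z$ and 1-cells $f_i\colon A_i\to Z$ there are a 1-cell $f\colon A_1\amalg A_2\to Z$ and 2-cells $\xi_i\colon f\circ\iota_i\Rightarrow f_i$; (ii) for any two such triplets $(f,\xi_1,\xi_2)$, $(f',\xi_1',\xi_2')$ there is a unique 2-cell $\eta\colon f\Rightarrow f'$ with $\xi_i'\cdot(\eta\circ\iota_i)=\xi_i$. Bipullback. A bipullback of 1-cells $f_i\colon A_i\to B$ ($i=1,2$) is a 0-cell $P$ with 1-cells $\pi_i\colon P\to A_i$ and a 2-cell $\kappa\colon f_1\circ\pi_1\Rightarrow f_2\circ\pi_2$ such that: (i) for any 0-cell $Q$, 1-cells $g_i\colon Q\to A_i$ and 2-cell $\varepsilon\colon f_1\circ g_1\Rightarrow f_2\circ g_2$, there are a 1-cell $g\colon Q\to P$ and 2-cells $\xi_i\colon\pi_i\circ g\Rightarrow g_i$ with $\varepsilon\cdot(f_1\circ\xi_1)=(f_2\circ\xi_2)\cdot(\kappa\circ g)$; (ii) for any two such triplets $(g,\xi_1,\xi_2)$, $(g',\xi_1',\xi_2')$ there is a unique 2-cell $\zeta\colon g\Rightarrow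 g'$ with $\xi_i'\cdot(\pi_i\circ\zeta)=\xi_i$. Bicoproducts and bipullbacks exist in $\mathbb{S}$. Functors attached to a 1-cell $\frac{\alpha}{\theta}\colon\frac{X}{G}\to\frac{Y}{H}$. $(\frac{\alpha}{\theta})^*\colon{}_H\mathrm{set}/Y\to{}_G\mathrm{set}/X$ sends $(B,\mathfrak{b})$ to the set $X\times_YB=\{(x,b)\mid\alpha(x)=\mathfrak{b}(b)\}$ with $G$-action $g(x,b)=(gx,\theta_x(g)b)$ and the projection to $X$, and sends a morphism $f$ to $(x,b)\mapsto(x,f(b))$. For $(A,\mathfrak{a})\in{}_G\mathrm{set}/X$, let $H\times_GA=(H\times A)/\sim$, where $(\eta,a)\sim(\eta',a')$ iff there is $g\in G$ with $a'=ga$ and $\eta=\eta'\theta_{\mathfrak{a}(a)}(g)$; the class of $(\eta,a)$ is $[\eta,a]$ and $H$ acts by $h[\eta,a]=[h\eta,a]$. For $(A,\mathfrak{a})=(X,\mathrm{id}_X)$ put $\mathrm{SIm}(\frac{\alpha}{\theta})=H\times_GX$, and let $\widetilde{\alpha}\colon\mathrm{SIm}(\frac{\alpha}{\theta})\to Y$ be the $H$-map $[\eta,x]\mapsto\eta\alpha(x)$. The functor $S_\theta\colon{}_G\mathrm{set}/X\to{}_H\mathrm{set}/\mathrm{SIm}(\frac{\alpha}{\theta})$ sends $(A,\mathfrak{a})$ to $H\times_GA\to H\times_GX$, $[\eta,a]\mapsto[\eta,\mathfrak{a}(a)]$, and $f$ to $[\eta,a]\mapsto[\eta,f(a)]$.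 The functor $(\frac{\alpha}{\theta})_+\colon{}_G\mathrm{set}/X\to{}_H\mathrm{set}/Y$ is $S_\theta$ followed by composition with $\widetilde{\alpha}$. The endofunctor $(-)^\theta$ of ${}_G\mathrm{set}/X$ sends $(A,\mathfrak{a})$ to $(A^\theta,\mathfrak{a}|_{A^\theta})$, where $A^\theta\subseteq A$ is the $G$-subset of those $a\in A$ such that for all $g,g'\in G$: if $\theta_{\mathfrak{a}(a)}(g)=\theta_{\mathfrak{a}(a)}(g')$ and $g\mathfrak{a}(a)=g'\mathfrak{a}(a)$, then $ga=g'a$. It sends a morphism to its restriction. For an $H$-map $f\colon V\to Y$, the functor $\Pi_f\colon{}_H\mathrm{set}/V\to{}_H\mathrm{set}/Y$ sends $(B,\mathfrak{b})$ to the set $\Pi_f(B)$ of pairs $(y,\sigma)$ with $y\in Y$ and $\sigma\colon f^{-1}(y)\to B$ a map such that $\mathfrak{b}\circ\sigma$ is the inclusion $f^{-1}(y)\hookrightarrow V$, with $H$-action $h(y,\sigma)=(hy,{}^h\sigma)$, ${}^h\sigma(v)=h\sigma(h^{-1}v)$, and with the projection to $Y$; it sends a morphism $k$ to $(y,\sigma)\mapsto(y,k\circ\sigma)$. The functor $(\frac{\alpha}{\theta})_\bullet$ is $\Pi_{\widetilde{\alpha}}\circ S_\theta\circ(-)^\theta\colon{}_G\mathrm{set}/X\to{}_H\mathrm{set}/Y$. One has $(\frac{\alpha}{\theta})_+\dashv(\frac{\alpha}{\theta})^*\dashv(\frac{\alpha}{\theta})_\bullet$. Partial exponential diagram of $\frac{\alpha}{\theta}$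 and $(A,\mathfrak{a})$. Write $(\frac{\alpha}{\theta})_\bullet(A,\mathfrak{a})=(P\xrightarrow{\pi_Y}Y)$, so $P=\Pi_{\widetilde{\alpha}}(H\times_GA^\theta)$, and $(\frac{\alpha}{\theta})^*(\frac{\alpha}{\theta})_\bullet(A,\mathfrak{a})=(X\times_YP\to X)$. Let $\zeta\colon X\times_YP\to A$ be the component at $(A,\mathfrak{a})$ of the counit of $(\frac{\alpha}{\theta})^*\dashv(\frac{\alpha}{\theta})_\bullet$; explicitly, $\zeta(x,(y,\sigma))$ is the unique $a_0\in A^\theta$ with $[e,a_0]=\sigma([e,x])$ in $H\times_GA^\theta$ and $\mathfrak{a}(a_0)=x$. Let $\frac{\alpha^\diamond}{\theta^\diamond}\colon\frac{X\times_YP}{G}\to\frac{P}{H}$ be the 1-cell with $\alpha^\diamond(x,p)=p$ and $\theta^\diamond_{(x,p)}=\theta_x$. Burnside rings. $\mathfrak{A}(\frac{X}{G})$ is the set of isomorphism classes of objects of ${}_G\mathrm{set}/X$, a commutative semi-ring under coproducts and products (fibered products over $X$). $\Omega(\frac{X}{G})=K_0(\mathfrak{A}(\frac{X}{G}))$ is its additive completion (Grothendieck ring). Let $\mathfrak{A}^*(\frac{\alpha}{\theta})\colon\mathfrak{A}(\frac{Y}{H})\to\mathfrak{A}(\frac{X}{G})$ and $\mathfrak{A}_+(\frac{\alpha}{\theta}),\mathfrak{A}_\bullet(\frac{\alpha}{\theta})\colon\mathfrak{A}(\frac{X}{G})\to\mathfrak{A}(\frac{Y}{H})$ be the maps induced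 by $(\frac{\alpha}{\theta})^*,(\frac{\alpha}{\theta})_+,(\frac{\alpha}{\theta})_\bullet$. A map $\varphi\colon A\to M$ from an additive (commutative) monoid to an abelian group is polynomial if $\varphi=0$ or there is a positive integer $n$ with $D_{(a_1,\dots,a_n)}\varphi=0$ for all $a_1,\dots,a_n\in A$, where $D_{(a_1,\dots,a_n)}\varphi(x)=\sum_{k=0}^n\sum_{1\le i_1<\dots<i_k\le n}(-1)^{n-k}\varphi(x+a_{i_1}+\dots+a_{i_k})$; a map $\varphi\colon A\to B$ of additive monoids is polynomial if $\kappa_B\circ\varphi\colon A\to K_0B$ is, with $\kappa_B\colon B\to K_0B$ the group completion. A polynomial map $\varphi\colon A\to B$ extends uniquely to a polynomial map $\widetilde{\varphi}\colon K_0A\to K_0B$ with $\widetilde{\varphi}\circ\kappa_A=\kappa_B\circ\varphi$. The maps $\mathfrak{A}^*(\frac{\alpha}{\theta}),\mathfrak{A}_+(\frac{\alpha}{\theta}),\mathfrak{A}_\bullet(\frac{\alpha}{\theta})$ are polynomial, and $\Omega^*(\frac{\alpha}{\theta}),\Omega_+(\frac{\alpha}{\theta}),\Omega_\bullet(\frac{\alpha}{\theta})$ denote their unique polynomial extensions to the rings $\Omega$. Semi-Mackey functor on $\mathbb{S}$: a pair $(S^*,S_* )$ of strict 2-functors $S^*\colon\mathbb{S}^{\mathrm{op}}\to\mathit{Set}$, $S_*\colon\mathbb{S}\to\mathit{Set}$ ($\mathit{Set}$ having only identity 2-cells, so 1-cells connected by a 2-cell have equal images) such that: (1) $S^*(\frac{X}{G})=S_*(\frac{X}{G})$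 for every 0-cell; this set is written $S(\frac{X}{G})$; (2) for each bicoproduct $A_1\xrightarrow{\iota_1}A_1\amalg A_2\xleftarrow{\iota_2}A_2$, the map $(S^*(\iota_1),S^*(\iota_2))\colon S(A_1\amalg A_2)\to S(A_1)\times S(A_2)$ is a bijection; (3) for each bipullback with $\pi_i\colon P\to A_i$ of $f_i\colon A_i\to B$, $S^*(f_1)\circ S_*(f_2)=S_*(\pi_1)\circ S^*(\pi_2)$. Then each $S(\frac{X}{G})$ carries a natural commutative monoid structure, with operation $S(\frac{X}{G})\times S(\frac{X}{G})\cong S(\frac{X}{G}\amalg\frac{X}{G})\xrightarrow{S_*(\nabla)}S(\frac{X}{G})$, $\nabla$ the codiagonal 1-cell, and unit given by $S_*$ of the 1-cell from the initial 0-cell $\frac{\emptyset}{e}$. $(S^*,S_* )$ is a Mackey functor if this monoid is an abelian group for every $\frac{X}{G}$. *)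

(* Defs.v *)
From HB Require Import structures.
From mathcomp Require Import all_boot all_order all_algebra all_fingroup.
From mathcomp Require Import generic_quotient.
From mathcomp Require Import boolp classical_sets.

Set Implicit Arguments.
Unset Strict Implicit.
Unset Printing Implicit Defensive.

Local Open Scope quotient_scope.
Local Open Scope group_scope.

Reserved Notation "g *> x" (at level 38, right associativity).
Reserved Notation "g \o1 f" (at level 50, left associativity).

(* Finite G-sets have left actions, whereas {action gT &-> T} of MathComp is  *)
(* a type of right actions.                                                   *)

Record gset (G : finGroupType) := GSet {
  gcarrier :> finType;
  gact : G -> gcarrier -> gcarrier;
  gact1 : forall x, gact 1 x = x;
  gactM : forall g g' x, gact (g * g') x = gact g (gact g' x) }.

Notation "g *> x" := (gact g x) : group_scope.

Record gmap (G : finGroupType) (V Y : gset G) := GMap {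
  gmap_fun :> V -> Y;
  gmapE : forall g v, gmap_fun (g *> v) = g *> gmap_fun v }.

Record slice (G : finGroupType) (X : gset G) := Slice {
  stot :> gset G;
  sproj : gmap stot X }.

Record slice_hom (G : finGroupType) (X : gset G) (A B : slice X) := SliceHom {
  hom_gmap :> gmap A B;
  hom_proj : forall a, sproj B (hom_gmap a) = sproj A a }.

Definition slice_iso (G : finGroupType) (X : gset G) (A B : slice X) : Prop :=
  exists (f : slice_hom A B) (f' : slice_hom B A), cancel f f' /\ cancel f' f.

Section GsetTheory.
Variables (G : finGroupType).

Lemma gactK (X : gset G) (g : G) : cancel (@gact G X g) (gact g^-1).
Proof. by move=> x; rewrite -gactM mulVg gact1. Qed.

Lemma gactKV (X : gset G) (g : G) : cancel (@gact G X g^-1) (gact g).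
Proof. by move=> x; rewrite -gactM mulgV gact1. Qed.

Definition gmap_id (X : gset G) : gmap X X := @GMap G X X id (fun _ _ => erefl).

Definition slice_id (X : gset G) : slice X := Slice (gmap_id X).

Lemma gmap_comp_subproof (U V W : gset G) (p : gmap V W) (q : gmap U V) g u :
  p (q (g *> u)) = g *> p (q u).
Proof. by rewrite !gmapE. Qed.

Definition gmap_comp (U V W : gset G) (p : gmap V W) (q : gmap U V) :
  gmap U W := GMap (gmap_comp_subproof p q).

Definition slice_postcomp (V Y : gset G) (p : gmap V Y) (B : slice V) :
  slice Y := Slice (gmap_comp p (sproj B)).

Definition slice_postcomp_map (V Y : gset G) (p : gmap V Y) (A B : slice V)
  (k : slice_hom A B) : slice_hom (slice_postcomp p A) (slice_postcomp p B) :=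
  @SliceHom G Y (slice_postcomp p A) (slice_postcomp p B) k
    (fun a => congr1 p (hom_proj k a)).

Variable X : gset G.
Implicit Types A B C : slice X.

Lemma slice_isoI A B (f : A -> B) (f' : B -> A) :
    (forall g a, f (g *> a) = g *> f a) ->
    (forall a, sproj B (f a) = sproj A a) ->
  cancel f f' -> cancel f' f -> slice_iso A B.
Proof.
move=> fE fP fK f'K.
have f'E g b : f' (g *> b) = g *> f' b by rewrite -{1}(f'K b) -fE fK.
have f'P b : sproj A (f' b) = sproj B b by rewrite -fP f'K.
by exists (@SliceHom _ _ A B (GMap fE) fP), (@SliceHom _ _ B A (GMap f'E) f'P).
Qed.

Lemma slice_iso_refl A : slice_iso A A.
Proof. exact: (@slice_isoI A A id id). Qed.

Lemma slice_iso_sym A B : slice_iso A B -> slice_iso B A.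
Proof. by case=> f [f' [fK f'K]]; exists f', f. Qed.

Lemma slice_iso_trans A B C :
  slice_iso A B -> slice_iso B C -> slice_iso A C.
Proof.
case=> f [f' [fK f'K]] [h [h' [hK h'K]]].
apply: (@slice_isoI A C (h \o f) (f' \o h')).
- by move=> g a /=; rewrite !gmapE.
- by move=> a /=; rewrite !hom_proj.
- exact: can_comp.
- exact: can_comp.
Qed.

End GsetTheory.

(* Cell0 X, with X : gset G, is the 0-cell X/G.                               *)
Record cell0 := Cell0 { cgrp : finGroupType; cset :> gset cgrp }.

(* The 1-cell alpha/theta has components c1map = alpha and c1coc = theta.      *)
Record cell1 (X Y : cell0) := Cell1 {
  c1map :> X -> Y;
  c1coc : X -> cgrp X -> cgrp Y;
  c1mapE : forall g x, c1map (g *> x) = c1coc x g *> c1map x;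
  c1cocM : forall x g g', c1coc x (g * g') = c1coc (g' *> x) g * c1coc x g' }.

Lemma c1coc1 (X Y : cell0) (f : cell1 X Y) x : c1coc f x 1 = 1.
Proof.
have := c1cocM f x 1 1; rewrite mulg1 gact1 => e.
by apply: (mulgI (c1coc f x 1)); rewrite -e mulg1.
Qed.

Lemma c1cocV (X Y : cell0) (f : cell1 X Y) x g :
  c1coc f (g *> x) g^-1 = (c1coc f x g)^-1.
Proof. by apply: (mulIg (c1coc f x g)); rewrite -c1cocM !mulVg c1coc1. Qed.

Definition cell1_of_gmap (G : finGroupType) (X Y : gset G) (a : gmap X Y) :
  cell1 (Cell0 X) (Cell0 Y) :=
  @Cell1 (Cell0 X) (Cell0 Y) a (fun _ g => g) (gmapE a) (fun _ _ _ => erefl).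

Definition cell1_id (X : cell0) : cell1 X X :=
  @Cell1 X X id (fun _ g => g) (fun _ _ => erefl) (fun _ _ _ => erefl).

Section Cell1Comp.
Variables (X Y Z : cell0) (b : cell1 Y Z) (f : cell1 X Y).

Definition comp_coc (x : X) (g : cgrp X) : cgrp Z := c1coc b (f x) (c1coc f x g).

Lemma comp_mapE g x : b (f (g *> x)) = comp_coc x g *> b (f x).
Proof. by rewrite !c1mapE. Qed.

Lemma comp_cocM x g g' :
  comp_coc x (g * g') = comp_coc (g' *> x) g * comp_coc x g'.
Proof. by rewrite /comp_coc !c1cocM c1mapE. Qed.

Definition cell1_comp : cell1 X Z :=
  @Cell1 X Z (fun x => b (f x)) comp_coc comp_mapE comp_cocM.

End Cell1Comp.

Notation "g \o1 f" := (cell1_comp g f) : group_scope.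

(* A 2-cell f => f' is a family e : X -> H satisfying is_cell2 f f' e; two    *)
(* 2-cells are compared pointwise.                                            *)
Definition is_cell2 (X Y : cell0) (f f' : cell1 X Y) (e : X -> cgrp Y) : Prop :=
  (forall x, f' x = e x *> f x) /\
  (forall x g, e (g *> x) * c1coc f x g * (e x)^-1 = c1coc f' x g).

Definition vcomp (X Y : cell0) (e' e : X -> cgrp Y) : X -> cgrp Y :=
  fun x => e' x * e x.

(* whiskl b f e is the whiskering b \o e of a 2-cell e with source f.         *)
Definition whiskl (X Y Z : cell0) (b : cell1 Y Z) (f : cell1 X Y)
  (e : X -> cgrp Y) : X -> cgrp Z := fun x => c1coc b (f x) (e x).

Definition whiskr (X Y Z : cell0) (d : Y -> cgrp Z) (f : cell1 X Y) :
  X -> cgrp Z := fun x => d (f x).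

Lemma cell2_vcomp (X Y : cell0) (f f' f'' : cell1 X Y) e e' :
  is_cell2 f f' e -> is_cell2 f' f'' e' -> is_cell2 f f'' (vcomp e' e).
Proof.
case=> eM eC [e'M e'C]; split=> [x | x g]; first by rewrite e'M eM gactM.
by rewrite -e'C -eC /vcomp invMg !mulgA.
Qed.

Lemma cell2_inv (X Y : cell0) (f f' : cell1 X Y) e :
  is_cell2 f f' e -> is_cell2 f' f (fun x => (e x)^-1).
Proof.
case=> eM eC; split=> [x | x g]; first by rewrite eM gactK.
by rewrite -eC !mulgA mulVg mul1g mulgK.
Qed.

Definition is_bicoproduct (A1 A2 C : cell0) (i1 : cell1 A1 C) (i2 : cell1 A2 C)
    : Prop :=
  (forall (Z : cell0) (f1 : cell1 A1 Z) (f2 : cell1 A2 Z),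
     exists (f : cell1 C Z) (x1 : A1 -> cgrp Z) (x2 : A2 -> cgrp Z),
       is_cell2 (f \o1 i1) f1 x1 /\ is_cell2 (f \o1 i2) f2 x2) /\
  (forall (Z : cell0) (f1 : cell1 A1 Z) (f2 : cell1 A2 Z)
     (f : cell1 C Z) (x1 : A1 -> cgrp Z) (x2 : A2 -> cgrp Z)
     (f' : cell1 C Z) (x1' : A1 -> cgrp Z) (x2' : A2 -> cgrp Z),
     is_cell2 (f \o1 i1) f1 x1 -> is_cell2 (f \o1 i2) f2 x2 ->
     is_cell2 (f' \o1 i1) f1 x1' -> is_cell2 (f' \o1 i2) f2 x2' ->
     let comparison (eta : C -> cgrp Z) :=
       [/\ is_cell2 f f' eta, vcomp x1' (whiskr eta i1) =1 x1
         & vcomp x2' (whiskr eta i2) =1 x2] in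
     exists2 eta, comparison eta & forall eta', comparison eta' -> eta' =1 eta).

Definition is_bipullback (A1 A2 B P : cell0) (f1 : cell1 A1 B) (f2 : cell1 A2 B)
    (p1 : cell1 P A1) (p2 : cell1 P A2) (kap : P -> cgrp B) : Prop :=
  let is_cone (Q : cell0) (g1 : cell1 Q A1) (g2 : cell1 Q A2)
        (e : Q -> cgrp B) (g : cell1 Q P)
        (x1 : Q -> cgrp A1) (x2 : Q -> cgrp A2) :=
    [/\ is_cell2 (p1 \o1 g) g1 x1, is_cell2 (p2 \o1 g) g2 x2 &
        vcomp e (whiskl f1 (p1 \o1 g) x1)
          =1 vcomp (whiskl f2 (p2 \o1 g) x2) (whiskr kap g)] in
  [/\ is_cell2 (f1 \o1 p1) (f2 \o1 p2) kap,
      forall (Q : cell0) (g1 : cell1 Q A1) (g2 : cell1 Q A2) (e : Q -> cgrp B),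
        is_cell2 (f1 \o1 g1) (f2 \o1 g2) e ->
        exists (g : cell1 Q P) (x1 : Q -> cgrp A1) (x2 : Q -> cgrp A2),
          is_cone Q g1 g2 e g x1 x2
    & forall (Q : cell0) (g1 : cell1 Q A1) (g2 : cell1 Q A2) (e : Q -> cgrp B)
        (g : cell1 Q P) (x1 : Q -> cgrp A1) (x2 : Q -> cgrp A2)
        (g' : cell1 Q P) (x1' : Q -> cgrp A1) (x2' : Q -> cgrp A2),
        is_cell2 (f1 \o1 g1) (f2 \o1 g2) e ->
        is_cone Q g1 g2 e g x1 x2 -> is_cone Q g1 g2 e g' x1' x2' ->
        let comparison (z : Q -> cgrp P) :=
          [/\ is_cell2 g g' z, vcomp x1' (whiskl p1 g z) =1 x1
            & vcomp x2' (whiskl p2 g z) =1 x2] in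
        exists2 z, comparison z & forall z', comparison z' -> z' =1 z].

(* The group of the initial 0-cell is the one-element group 'I_1.             *)
Definition gset_empty (G : finGroupType) : gset G :=
  @GSet G void (fun _ x => x) (fun _ => erefl) (fun _ _ _ => erefl).

Definition cell0_empty : cell0 := Cell0 (gset_empty 'I_1).

Definition cell1_init (X : cell0) : cell1 cell0_empty X :=
  @Cell1 cell0_empty X (fun x : void => match x with end)
    (fun x : void => match x with end)
    (fun _ (x : void) => match x with end)
    (fun x : void => match x with end).

(* up = S^* and dn = S_*.                                                     *)
Section Mackey.
Variables (S : cell0 -> Type)
  (up : forall X Y : cell0, cell1 X Y -> S Y -> S X)
  (dn : forall X Y : cell0, cell1 X Y -> S X -> S Y).

Record is_semi_mackey : Prop := IsSemiMackey {
  up_id : forall X, up (cell1_id X) =1 id;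
  up_comp : forall (X Y Z : cell0) (g : cell1 Y Z) (f : cell1 X Y),
    up (g \o1 f) =1 up f \o up g;
  up_cell2 : forall (X Y : cell0) (f f' : cell1 X Y) e,
    is_cell2 f f' e -> up f =1 up f';
  dn_id : forall X, dn (cell1_id X) =1 id;
  dn_comp : forall (X Y Z : cell0) (g : cell1 Y Z) (f : cell1 X Y),
    dn (g \o1 f) =1 dn g \o dn f;
  dn_cell2 : forall (X Y : cell0) (f f' : cell1 X Y) e,
    is_cell2 f f' e -> dn f =1 dn f';
  up_bicoproduct : forall (A1 A2 C : cell0) (i1 : cell1 A1 C) (i2 : cell1 A2 C),
    is_bicoproduct i1 i2 -> bijective (fun u : S C => (up i1 u, up i2 u));
  up_dn_bipullback : forall (A1 A2 B P : cell0)
      (f1 : cell1 A1 B) (f2 : cell1 A2 B) (p1 : cell1 P A1) (p2 : cell1 P A2) kap,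
    is_bipullback f1 f2 p1 p2 kap -> up f1 \o dn f2 =1 dn p1 \o up p2 }.

(* add is the operation S(X) * S(X) ~ S(X + X) -> S(X), for all choices of    *)
(* a bicoproduct X + X and of a codiagonal; choices exist by bicoproduct_sum  *)
(* and codiagonal_sum below.                                                  *)
Definition is_mackey_add (X : cell0) (add : S X -> S X -> S X) : Prop :=
  forall (C : cell0) (i1 i2 : cell1 X C) (nabla : cell1 C X) e1 e2,
    is_bicoproduct i1 i2 ->
    is_cell2 (nabla \o1 i1) (cell1_id X) e1 ->
    is_cell2 (nabla \o1 i2) (cell1_id X) e2 ->
    forall u : S C, add (up i1 u) (up i2 u) = dn nabla u.

Definition is_mackey_zero (X : cell0) (zero : S X) : Prop :=
  exists z : S cell0_empty, zero = dn (cell1_init X) z.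

Definition is_mackey : Prop :=
  is_semi_mackey /\
  forall X : cell0, exists (add : S X -> S X -> S X) (zero : S X),
    [/\ is_mackey_add add, is_mackey_zero zero &
        [/\ associative add, commutative add, left_id zero add
          & forall s, exists t, add t s = zero]].

End Mackey.

Section SumGset.
Variables (G : finGroupType) (X Y : gset G).

Definition sum_act (g : G) (u : X + Y) : X + Y :=
  match u with inl x => inl (g *> x) | inr y => inr (g *> y) end.

Lemma sum_act1 u : sum_act 1 u = u.
Proof. by case: u => x /=; rewrite gact1. Qed.

Lemma sum_actM g g' u : sum_act (g * g') u = sum_act g (sum_act g' u).
Proof. by case: u => x /=; rewrite gactM. Qed.

Definition gset_sum : gset G := @GSet G (X + Y)%type sum_act sum_act1 sum_actM.

Definition gmap_inl : gmap X gset_sum := @GMap G X gset_sum inl (fun _ _ => erefl).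
Definition gmap_inr : gmap Y gset_sum := @GMap G Y gset_sum inr (fun _ _ => erefl).

Definition sum_fun (Z : gset G) (p : gmap X Z) (q : gmap Y Z) (u : gset_sum) : Z :=
  match u with inl x => p x | inr y => q y end.

Lemma sum_funE (Z : gset G) (p : gmap X Z) (q : gmap Y Z) g u :
  sum_fun p q (g *> u) = g *> sum_fun p q u.
Proof. by case: u => x /=; rewrite gmapE. Qed.

Definition gmap_sum (Z : gset G) (p : gmap X Z) (q : gmap Y Z) : gmap gset_sum Z :=
  GMap (sum_funE p q).

Lemma bicoproduct_sum :
  is_bicoproduct (cell1_of_gmap gmap_inl) (cell1_of_gmap gmap_inr).
Proof.
split=> [Z f1 f2 | Z f1 f2 f x1 x2 f' x1' x2'].
  pose al (u : gset_sum) : Z := match u with inl x => f1 x | inr y => f2 y end.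
  pose th (u : gset_sum) := match u with inl x => c1coc f1 x | inr y => c1coc f2 y end.
  have alE g u : al (g *> u) = th u g *> al u.
    by case: u => x /=; [exact: (c1mapE f1) | exact: (c1mapE f2)].
  have thM u g g' : th u (g * g') = th (g' *> u) g * th u g'.
    by case: u => x /=; [exact: (c1cocM f1) | exact: (c1cocM f2)].
  exists (@Cell1 (Cell0 gset_sum) Z al th alE thM), (fun=> 1), (fun=> 1).
  by split; split=> x *; rewrite ?gact1 //= mul1g invg1 mulg1.
move=> c1 c2 c1' c2' comparison.
pose eta (u : gset_sum) : cgrp Z :=
  match u with inl x => (x1' x)^-1 * x1 x | inr y => (x2' y)^-1 * x2 y end.
exists eta.
  split=> [|x|y]; rewrite /vcomp /whiskr /= ?mulKVg //.
  have [m1 t1] := cell2_vcomp c1 (cell2_inv c1').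
  have [m2 t2] := cell2_vcomp c2 (cell2_inv c2').
  by split=> [[x|y]|[x|y] g]; [exact: m1|exact: m2|exact: t1|exact: t2].
move=> eta' [_ h1 h2] [x|y] /=.
  by rewrite -h1 mulKg.
by rewrite -h2 mulKg.
Qed.

End SumGset.

Lemma codiagonal_sum (G : finGroupType) (X : gset G) (Y := Cell0 X)
    (nabla := cell1_of_gmap (gmap_sum (gmap_id X) (gmap_id X))) :
  is_cell2 (nabla \o1 cell1_of_gmap (gmap_inl X X)) (cell1_id Y) (fun=> 1) /\
  is_cell2 (nabla \o1 cell1_of_gmap (gmap_inr X X)) (cell1_id Y) (fun=> 1).
Proof. by split; split=> x *; rewrite ?gact1 //= mul1g invg1 mulg1. Qed.


Section Pullback.
Variables (X Y : cell0) (f : cell1 X Y).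

Section Obj.
Variable B : slice Y.

Definition pb_type : finType := {p : X * B | f p.1 == sproj B p.2}.

Lemma pb_act_subproof (g : cgrp X) (p : pb_type) :
  f (g *> (val p).1) == sproj B (c1coc f (val p).1 g *> (val p).2).
Proof. by rewrite c1mapE gmapE (eqP (valP p)). Qed.

Definition pb_act (g : cgrp X) (p : pb_type) : pb_type :=
  exist _ (g *> (val p).1, c1coc f (val p).1 g *> (val p).2) (pb_act_subproof g p).

Lemma pb_act1 p : pb_act 1 p = p.
Proof.
by apply/val_inj; case: p => -[x b] ? /=; rewrite c1coc1 !gact1.
Qed.

Lemma pb_actM g g' p : pb_act (g * g') p = pb_act g (pb_act g' p).
Proof. by apply/val_inj; rewrite /= c1cocM !gactM. Qed.

Definition pb_gset : gset (cgrp X) := GSet pb_act1 pb_actM.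

Definition pb_proj : gmap pb_gset X :=
  @GMap _ pb_gset X (fun p => (val p).1) (fun _ _ => erefl).

(* f^*                                                                        *)
Definition star_obj : slice X := Slice pb_proj.

End Obj.

Section Map.
Variables (B B' : slice Y) (k : slice_hom B B').

Lemma star_map_subproof (p : star_obj B) : f (val p).1 == sproj B' (k (val p).2).
Proof. by rewrite hom_proj (valP p). Qed.

Definition star_map_fun (p : star_obj B) : star_obj B' :=
  exist _ ((val p).1, k (val p).2) (star_map_subproof p).

Lemma star_mapE g p : star_map_fun (g *> p) = g *> star_map_fun p.
Proof. by apply/val_inj; rewrite /= gmapE. Qed.

Definition star_map : slice_hom (star_obj B) (star_obj B') :=
  @SliceHom _ _ (star_obj B) (star_obj B') (GMap star_mapE) (fun=> erefl).

End Map.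

Lemma star_iso B B' : slice_iso B B' -> slice_iso (star_obj B) (star_obj B').
Proof.
case=> k [k' [kK k'K]]; exists (star_map k), (star_map k').
by split=> -[[x b] ?]; apply/val_inj; rewrite /= ?kK ?k'K.
Qed.

End Pullback.

Section Balanced.
Variables (X Y : cell0) (f : cell1 X Y).

Section Obj.
Variable A : slice X.

Definition bal_rel (p q : cgrp Y * A) : bool :=
  [exists g : cgrp X, (q.2 == g *> p.2) && (p.1 == q.1 * c1coc f (sproj A p.2) g)].

Lemma bal_refl : reflexive bal_rel.
Proof. by move=> p; apply/existsP; exists 1; rewrite gact1 c1coc1 mulg1 !eqxx. Qed.

Lemma bal_sym : symmetric bal_rel.
Proof.
suff imp p q : bal_rel p q -> bal_rel q p by move=> p q; apply/idP/idP; apply: imp.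
case/existsP=> g /andP[/eqP a2 /eqP h1]; apply/existsP; exists g^-1.
by rewrite a2 gactK h1 eqxx /= gmapE c1cocV mulgK.
Qed.

Lemma bal_trans : transitive bal_rel.
Proof.
move=> q p r /existsP[g /andP[/eqP a2 /eqP h1]] /existsP[g' /andP[/eqP b2 /eqP h2]].
apply/existsP; exists (g' * g).
by rewrite b2 a2 gactM eqxx h1 h2 a2 gmapE c1cocM mulgA /=.
Qed.

Canonical bal_equiv := EquivRel bal_rel bal_refl bal_sym bal_trans.

Definition bal_type : Type := {eq_quot bal_equiv}.
HB.instance Definition _ := EqQuotient.on bal_type.
HB.instance Definition _ := Finite.copy bal_type (can_type (EquivQuot.ereprK (eD := bal_equiv) )).

(* bal_class h a is [h, a] in H *_G A, where H = cgrp Y and G = cgrp X.       *)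
Definition bal_class (h : cgrp Y) (a : A) : bal_type := \pi_({eq_quot bal_equiv}) (h, a).

Lemma bal_classP h a h' a' :
  reflect (exists2 g, a' = g *> a & h = h' * c1coc f (sproj A a) g)
          (bal_class h a == bal_class h' a').
Proof.
rewrite /bal_class -[_ == _]/(_ == _ :> {eq_quot bal_equiv}) eqmodE.
apply: (iffP existsP) => [[g /andP[/eqP ? /eqP ?]]|[g -> ->]]; exists g => //=.
by rewrite !eqxx.
Qed.

Lemma bal_ind (P : bal_type -> Prop) :
  (forall h a, P (bal_class h a)) -> forall u, P u.
Proof. by move=> Pc; apply: quotW => -[h a]; apply: Pc. Qed.

Definition bal_fst (u : bal_type) : cgrp Y := (repr (u : {eq_quot bal_equiv})).1.
Definition bal_snd (u : bal_type) : A := (repr (u : {eq_quot bal_equiv})).2.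

Lemma bal_repr (u : bal_type) : bal_class (bal_fst u) (bal_snd u) = u.
Proof. by rewrite /bal_class -surjective_pairing; apply: reprK. Qed.

Lemma bal_lift (T : Type) (F : cgrp Y -> A -> T) :
    (forall h a g, F (h * c1coc f (sproj A a) g) a = F h (g *> a)) ->
  forall h a, F (bal_fst (bal_class h a)) (bal_snd (bal_class h a)) = F h a.
Proof.
move=> FE h a; have /eqP/bal_classP[g ea eh] := bal_repr (bal_class h a).
by rewrite eh FE -ea.
Qed.

Definition bal_act (h : cgrp Y) (u : bal_type) : bal_type :=
  bal_class (h * bal_fst u) (bal_snd u).

Lemma bal_actE h h' a : bal_act h (bal_class h' a) = bal_class (h * h') a.
Proof.
rewrite /bal_act; apply: (bal_lift (F := fun k b => bal_class (h * k) b)).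
by move=> k b g; apply/eqP/bal_classP; exists g; rewrite ?mulgA.
Qed.

Lemma bal_act1 u : bal_act 1 u = u.
Proof. by elim/bal_ind: u => h a; rewrite bal_actE mul1g. Qed.

Lemma bal_actM h h' u : bal_act (h * h') u = bal_act h (bal_act h' u).
Proof. by elim/bal_ind: u => k a; rewrite !bal_actE mulgA. Qed.

Definition bal_gset : gset (cgrp Y) :=
  @GSet (cgrp Y) bal_type bal_act bal_act1 bal_actM.

End Obj.

Arguments bal_class A h a : clear implicits.

(* sim = SIm(f), and sim_map is the H-map [h, x] |-> h alpha(x) (sim_funE).   *)
Definition sim : gset (cgrp Y) := bal_gset (slice_id X).

Definition sim_fun (u : sim) : Y := bal_fst u *> f (bal_snd u).

Lemma sim_funE h x : sim_fun (bal_class (slice_id X) h x) = h *> f x.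
Proof.
apply: (bal_lift (A := slice_id X) (F := fun k z => k *> f z)) => k z g.
by rewrite c1mapE gactM.
Qed.

Lemma sim_mapE h u : sim_fun (h *> u) = h *> sim_fun u.
Proof.
by elim/bal_ind: u => k x; rewrite [h *> _]bal_actE !sim_funE gactM.
Qed.

Definition sim_map : gmap sim Y := GMap sim_mapE.

Section Map.
Variables (A A' : slice X) (k : slice_hom A A').

Definition bal_map (u : bal_type A) : bal_type A' :=
  bal_class A' (bal_fst u) (k (bal_snd u)).

Lemma bal_mapE h a : bal_map (bal_class A h a) = bal_class A' h (k a).
Proof.
apply: (bal_lift (F := fun h b => bal_class A' h (k b))) => {}h {}a g.
by apply/eqP/bal_classP; exists g; rewrite ?gmapE ?hom_proj.
Qed.

Lemma bal_map_act h (u : bal_gset A) :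
  bal_map (h *> u) = (h *> (bal_map u : bal_gset A')).
Proof.
by elim/bal_ind: u => h' a; rewrite [h *> _]bal_actE !bal_mapE [RHS]bal_actE.
Qed.

Definition bal_gmap : gmap (bal_gset A) (bal_gset A') :=
  @GMap _ (bal_gset A) (bal_gset A') bal_map bal_map_act.

End Map.

Lemma slice_id_hom_subproof (A : slice X) a : sproj (slice_id X) (sproj A a) = sproj A a.
Proof. by []. Qed.

Definition slice_to_id (A : slice X) : slice_hom A (slice_id X) :=
  @SliceHom _ _ A (slice_id X) (sproj A) (@slice_id_hom_subproof A).

(* S_theta                                                                    *)
Definition S_obj (A : slice X) : slice sim := Slice (bal_gmap (slice_to_id A)).

Section SMap.
Variables (A A' : slice X) (k : slice_hom A A').

Lemma S_map_proj (u : S_obj A) : sproj (S_obj A') (bal_gmap k u) = sproj (S_obj A) u.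
Proof. by elim/bal_ind: u => h a; rewrite /= !bal_mapE /= hom_proj. Qed.

Definition S_map : slice_hom (S_obj A) (S_obj A') :=
  @SliceHom _ _ (S_obj A) (S_obj A') (bal_gmap k) S_map_proj.

End SMap.

Lemma S_iso A A' : slice_iso A A' -> slice_iso (S_obj A) (S_obj A').
Proof.
case=> k [k' [kK k'K]]; exists (S_map k), (S_map k').
by split=> u; elim/bal_ind: u => h a; rewrite /= !bal_mapE ?kK ?k'K.
Qed.

(* f_+                                                                        *)
Definition plus_obj (A : slice X) : slice Y := slice_postcomp sim_map (S_obj A).

Definition plus_map (A A' : slice X) (k : slice_hom A A') :
  slice_hom (plus_obj A) (plus_obj A') := slice_postcomp_map sim_map (S_map k).

Lemma plus_iso A A' : slice_iso A A' -> slice_iso (plus_obj A) (plus_obj A').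
Proof.
by case/S_iso=> k [k' kK]; exists (slice_postcomp_map _ k), (slice_postcomp_map _ k').
Qed.

End Balanced.

Arguments bal_class {X Y} f A h a.

(* theta_obj A is A^theta.                                                    *)
Section Theta.
Variables (X Y : cell0) (f : cell1 X Y).

Section Obj.
Variable A : slice X.

Definition theta_pred (a : A) : bool :=
  [forall g : cgrp X, forall g' : cgrp X,
     (c1coc f (sproj A a) g == c1coc f (sproj A a) g') &&
     (g *> sproj A a == g' *> sproj A a) ==> (g *> a == g' *> a)].

Lemma theta_predP a :
  reflect (forall g g', c1coc f (sproj A a) g = c1coc f (sproj A a) g' ->
             g *> sproj A a = g' *> sproj A a -> g *> a = g' *> a)
          (theta_pred a).
Proof.
apply: (iffP forallP) => [aP g g' e1 e2|aP g].
  by have /forallP/(_ g') := aP g; rewrite e1 e2 !eqxx => /eqP.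
by apply/forallP=> g'; apply/implyP=> /andP[/eqP e1 /eqP e2]; rewrite (aP g g').
Qed.

Definition theta_type : finType := {a : A | theta_pred a}.

Lemma theta_act_subproof (g : cgrp X) (a : theta_type) : theta_pred (g *> val a).
Proof.
have /theta_predP aP := valP a; apply/theta_predP => k k'.
rewrite gmapE -!gactM => e1 e2; apply: aP => //.
by rewrite !c1cocM e1.
Qed.

Definition theta_act (g : cgrp X) (a : theta_type) : theta_type :=
  exist _ (g *> val a) (theta_act_subproof g a).

Lemma theta_act1 a : theta_act 1 a = a.
Proof. by apply/val_inj; rewrite /= gact1. Qed.

Lemma theta_actM g g' a : theta_act (g * g') a = theta_act g (theta_act g' a).
Proof. by apply/val_inj; rewrite /= gactM. Qed.

Definition theta_gset : gset (cgrp X) := GSet theta_act1 theta_actM.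

Definition theta_incl : gmap theta_gset A :=
  @GMap _ theta_gset A val (fun _ _ => erefl).

Definition theta_obj : slice X := Slice (gmap_comp (sproj A) theta_incl).

End Obj.

Section Map.
Variables (A A' : slice X) (k : slice_hom A A').

Lemma theta_map_subproof (a : theta_obj A) : theta_pred (k (val a)).
Proof.
have /theta_predP aP := valP a; apply/theta_predP => g g'.
by rewrite hom_proj => e1 e2; rewrite -!(gmapE k) (aP g g').
Qed.

Definition theta_map_fun (a : theta_obj A) : theta_obj A' :=
  exist _ (k (val a)) (theta_map_subproof a).

Lemma theta_mapE g a : theta_map_fun (g *> a) = g *> theta_map_fun a.
Proof. by apply/val_inj; rewrite /= gmapE. Qed.

Definition theta_map : slice_hom (theta_obj A) (theta_obj A') :=
  @SliceHom _ _ (theta_obj A) (theta_obj A') (GMap theta_mapE)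
    (fun a => hom_proj k (val a)).

End Map.

Lemma theta_iso A A' : slice_iso A A' -> slice_iso (theta_obj A) (theta_obj A').
Proof.
case=> k [k' [kK k'K]]; exists (theta_map k), (theta_map k').
by split=> a; apply/val_inj; rewrite /= ?kK ?k'K.
Qed.

End Theta.

(* The functor Pi_p; an element is a pair (y, sigma) with sigma a section     *)
(* over the fiber of p at y.                                                  *)
Section Pi.
Variables (H : finGroupType) (V Y : gset H) (p : gmap V Y).

Definition fiber (y : Y) : finType := {v : V | p v == y}.

Lemma fiber_shift_subproof (h : H) (y : Y) (v : fiber (h *> y)) :
  p (h^-1 *> val v) == y.
Proof. by rewrite gmapE (eqP (valP v)) gactK. Qed.

Definition fiber_shift (h : H) (y : Y) (v : fiber (h *> y)) : fiber y :=
  exist _ (h^-1 *> val v) (fiber_shift_subproof v).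

Section Obj.
Variable B : slice V.

Definition pi_pred (s : {y : Y & {ffun fiber y -> B}}) : bool :=
  [forall v : fiber (tag s), sproj B (tagged s v) == val v].

Definition pi_type : finType := {s : {y : Y & {ffun fiber y -> B}} | pi_pred s}.

Definition pi_base (u : pi_type) : Y := tag (val u).
Definition pi_sec (u : pi_type) : {ffun fiber (pi_base u) -> B} := tagged (val u).

Lemma pi_secP (u : pi_type) v : sproj B (pi_sec u v) = val v.
Proof. exact/eqP/(forallP (valP u)). Qed.

Definition pi_mk_sig (y : Y) (s : {ffun fiber y -> B}) : {y : Y & {ffun fiber y -> B}} :=
  Tagged (fun y => {ffun fiber y -> B}) s.

Lemma pi_mk_subproof (y : Y) (s : {ffun fiber y -> B}) :
  (forall v, sproj B (s v) = val v) -> pi_pred (pi_mk_sig s).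
Proof. by move=> sP; apply/forallP=> v; apply/eqP/sP. Qed.

Definition pi_mk (y : Y) (s : {ffun fiber y -> B})
  (sP : forall v, sproj B (s v) = val v) : pi_type :=
  exist _ (pi_mk_sig s) (pi_mk_subproof sP).

Lemma pi_eq (u u' : pi_type) :
    pi_base u = pi_base u' ->
    (forall v v', val v = val v' -> pi_sec u v = pi_sec u' v') ->
  u = u'.
Proof.
case: u u' => [[y s] sP] [[y' s'] s'P]; rewrite /pi_base /pi_sec /= => e.
case: y' / e in s' s'P * => es; apply/val_inj => /=; congr existT.
by apply/ffunP => v; apply: es.
Qed.

Definition pi_act_sec (h : H) (u : pi_type) : {ffun fiber (h *> pi_base u) -> B} :=
  [ffun v => h *> pi_sec u (fiber_shift v)].

Lemma pi_act_subproof (h : H) (u : pi_type) v : sproj B (pi_act_sec h u v) = val v.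
Proof. by rewrite ffunE gmapE pi_secP /= gactKV. Qed.

Definition pi_act (h : H) (u : pi_type) : pi_type := pi_mk (@pi_act_subproof h u).

Lemma pi_act1 u : pi_act 1 u = u.
Proof.
apply: pi_eq => [|v v' e]; first exact: gact1.
rewrite [LHS]ffunE gact1; congr (pi_sec u _); apply/val_inj.
by rewrite /= e invg1 gact1.
Qed.

Lemma pi_actM h h' u : pi_act (h * h') u = pi_act h (pi_act h' u).
Proof.
apply: pi_eq => [|v v' e]; first exact: gactM.
rewrite [LHS]ffunE [RHS]ffunE [pi_sec (pi_act h' u) _]ffunE gactM.
by congr (_ *> (_ *> pi_sec u _)); apply/val_inj; rewrite /= e invMg gactM.
Qed.

Definition pi_gset : gset H := GSet pi_act1 pi_actM.

Definition pi_proj : gmap pi_gset Y :=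
  @GMap _ pi_gset Y pi_base (fun _ _ => erefl).

Definition pi_obj : slice Y := Slice pi_proj.

End Obj.

Section Map.
Variables (B B' : slice V) (k : slice_hom B B').

Definition pi_map_sec (u : pi_obj B) : {ffun fiber (pi_base u) -> B'} :=
  [ffun v => k (pi_sec u v)].

Lemma pi_map_subproof (u : pi_obj B) v : sproj B' (pi_map_sec u v) = val v.
Proof. by rewrite ffunE hom_proj pi_secP. Qed.

Definition pi_map_fun (u : pi_obj B) : pi_obj B' := pi_mk (@pi_map_subproof u).

Lemma pi_mapE h u : pi_map_fun (h *> u) = h *> pi_map_fun u.
Proof.
apply: pi_eq => // v v' e; rewrite [LHS]ffunE [RHS]ffunE [pi_sec _ _]ffunE gmapE.
rewrite [pi_sec (pi_map_fun u) _]ffunE; congr (_ *> k (pi_sec u _)).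
by apply/val_inj; rewrite /= e.
Qed.

Definition pi_map : slice_hom (pi_obj B) (pi_obj B') :=
  @SliceHom _ _ (pi_obj B) (pi_obj B') (GMap pi_mapE) (fun=> erefl).

End Map.

Lemma pi_iso B B' : slice_iso B B' -> slice_iso (pi_obj B) (pi_obj B').
Proof.
case=> k [k' [kK k'K]]; exists (pi_map k), (pi_map k').
by split=> u; apply: pi_eq => // v v' e; rewrite [LHS]ffunE [pi_sec _ _]ffunE
  ?kK ?k'K; congr (pi_sec u _); apply/val_inj.
Qed.

End Pi.

Arguments pi_secP {H V Y p B} u v.

Section Bullet.
Variables (X Y : cell0) (f : cell1 X Y).

(* f_bullet = Pi_(alpha~) \o S_theta \o (-)^theta                              *)
Definition bullet_obj (A : slice X) : slice Y :=
  pi_obj (sim_map f) (S_obj f (theta_obj f A)).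

Definition bullet_map (A A' : slice X) (k : slice_hom A A') :
  slice_hom (bullet_obj A) (bullet_obj A') :=
  pi_map (sim_map f) (S_map f (theta_map f k)).

Lemma bullet_iso A A' : slice_iso A A' -> slice_iso (bullet_obj A) (bullet_obj A').
Proof. by move=> iA; apply/pi_iso/S_iso/theta_iso. Qed.

End Bullet.

(* P, X *_Y P, the counit component zeta, characterized by zeta_pred (see      *)
(* zeta_unique), and the 1-cell alpha^diamond/theta^diamond.                  *)
Section Exponential.
Variables (X Y : cell0) (f : cell1 X Y) (A : slice X).

Definition exp_P : slice Y := bullet_obj f A.
Definition exp_E : slice X := star_obj f exp_P.

(* For t = (x, (y, sigma)), [e, x] as an element of the fiber over y.         *)
Lemma exp_point_subproof (t : exp_E) :
  sim_map f (bal_class f (slice_id X) 1 (val t).1) == pi_base (val t).2.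
Proof. by rewrite [sim_map f _]sim_funE gact1 (valP t). Qed.

Definition exp_point (t : exp_E) : fiber (sim_map f) (pi_base (val t).2) :=
  exist _ (bal_class f (slice_id X) 1 (val t).1) (exp_point_subproof t).

Definition zeta_pred (t : exp_E) (a0 : theta_obj f A) : bool :=
  (bal_class f (theta_obj f A) 1 a0 == pi_sec (val t).2 (exp_point t)) &&
  (sproj A (val a0) == (val t).1).

Lemma zeta_exists (t : exp_E) : exists a0, zeta_pred t a0.
Proof.
have := pi_secP (val t).2 (exp_point t).
rewrite /zeta_pred; elim/bal_ind: (pi_sec _ _) => h a /=.
rewrite bal_mapE => /eqP/bal_classP[/= g et eh]; exists (g *> a).
rewrite et gmapE eqxx andbT eq_sym; apply/bal_classP; exists g => //.
Qed.

Lemma zeta_unique (t : exp_E) a0 a1 : zeta_pred t a0 -> zeta_pred t a1 -> a0 = a1.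
Proof.
case/andP=> /eqP c0 /eqP x0 /andP[/eqP c1 /eqP x1].
have /eqP/bal_classP[g ea e1] : bal_class f (theta_obj f A) 1 a0 = bal_class f _ 1 a1.
  by rewrite c0 c1.
rewrite mul1g /= in e1; have /theta_predP/(_ g 1) := valP a0.
rewrite -e1 c1coc1 !gact1 -gmapE; have -> : g *> val a0 = val a1 by rewrite ea.
by rewrite x0 x1 => /(_ erefl erefl) e; apply/val_inj.
Qed.

Definition zeta_fun (t : exp_E) : A := val (xchoose (zeta_exists t)).

Lemma zeta_act g t : zeta_fun (g *> t) = g *> zeta_fun t.
Proof.
rewrite /zeta_fun -[RHS]/(val (g *> xchoose (zeta_exists t))); congr val.
apply: (@zeta_unique (g *> t)); first exact: xchooseP.
have /andP[/eqP c0 /eqP x0] := xchooseP (zeta_exists t); set a0 := xchoose _ in c0 x0 *.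
rewrite /zeta_pred /= gmapE x0 eqxx andbT.
rewrite [pi_sec _ _]ffunE.
have -> : fiber_shift (exp_point (g *> t)) = exp_point t.
  apply/val_inj; rewrite /= bal_actE mulg1.
  apply/eqP; rewrite eq_sym; apply/bal_classP; exists g => //=.
  by rewrite mulVg.
rewrite -c0 [_ *> _]bal_actE mulg1 eq_sym; apply/bal_classP; exists g => //=.
by rewrite mul1g x0.
Qed.

Definition zeta : gmap exp_E A := GMap zeta_act.

Definition exp_cell : cell1 (Cell0 exp_E) (Cell0 exp_P) :=
  @Cell1 (Cell0 exp_E) (Cell0 exp_P) (fun t => (val t).2)
    (fun t => c1coc f (val t).1) (fun _ _ => erefl)
    (fun t g g' => c1cocM f (val t).1 g g').

End Exponential.

(* The Burnside semi-ring.  For universe reasons the quotient by isomorphism  *)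
(* is taken on objects carried by an ordinal; burnside_ind, iso_classP show   *)
(* that burnside X is the set of isomorphism classes of all objects of        *)
(* G-set/X, iso_class A being the class of A.                                 *)

Section Burnside.
Variables (G : finGroupType) (X : gset G).

Record small := Small {
  small_card : nat;
  small_act : G -> 'I_small_card -> 'I_small_card;
  small_proj : 'I_small_card -> X;
  small_act1 : forall i, small_act 1 i = i;
  small_actM : forall g g' i, small_act (g * g') i = small_act g (small_act g' i);
  small_projE : forall g i, small_proj (small_act g i) = g *> small_proj i }.

Definition small_gset (s : small) : gset G :=
  @GSet G 'I_(small_card s) (@small_act s) (@small_act1 s) (@small_actM s).

Definition small_slice (s : small) : slice X :=
  @Slice G X (small_gset s) (@GMap G (small_gset s) X (@small_proj s) (@small_projE s)).

Section Transport.
Variable A : slice X.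

Definition to_small_act (g : G) (i : 'I_#|A|) : 'I_#|A| :=
  enum_rank (g *> enum_val i).

Lemma to_small_act1 i : to_small_act 1 i = i.
Proof. by rewrite /to_small_act gact1 enum_valK. Qed.

Lemma to_small_actM g g' i :
  to_small_act (g * g') i = to_small_act g (to_small_act g' i).
Proof. by rewrite /to_small_act gactM enum_rankK. Qed.

Lemma to_small_projE g i :
  sproj A (enum_val (to_small_act g i)) = g *> sproj A (enum_val i).
Proof. by rewrite enum_rankK gmapE. Qed.

Definition to_small : small := Small to_small_act1 to_small_actM to_small_projE.

Lemma to_small_iso : slice_iso A (small_slice to_small).
Proof.
apply: (@slice_isoI _ _ A (small_slice to_small) (@enum_rank A) enum_val).
- by move=> g a; rewrite /= /to_small_act enum_rankK.
- by move=> a; rewrite /= enum_rankK.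
- exact: enum_rankK.
- exact: enum_valK.
Qed.

End Transport.

Definition small_iso (s t : {classic small}) : bool :=
  `[< slice_iso (small_slice s) (small_slice t) >].

Lemma small_iso_refl : reflexive small_iso.
Proof. by move=> s; apply/asboolP/slice_iso_refl. Qed.

Lemma small_iso_sym : symmetric small_iso.
Proof. by move=> s t; apply/asboolP/asboolP; apply: slice_iso_sym. Qed.

Lemma small_iso_trans : transitive small_iso.
Proof.
by move=> t s u /asboolP st /asboolP tu; apply/asboolP; apply: slice_iso_trans tu.
Qed.

Canonical small_equiv := EquivRel small_iso small_iso_refl small_iso_sym small_iso_trans.

Definition burnside : Type := {eq_quot small_equiv}.
HB.instance Definition _ := Choice.on burnside.

Definition iso_class (A : slice X) : burnside := \pi_({eq_quot small_equiv}) (to_small A).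

Definition class_repr (c : burnside) : slice X :=
  small_slice (repr (c : {eq_quot small_equiv})).

Lemma iso_classP A B : iso_class A = iso_class B <-> slice_iso A B.
Proof.
rewrite /iso_class; split=> [/eqmodP/asboolP iAB|iAB].
  apply: slice_iso_trans (to_small_iso A) _; apply: slice_iso_trans iAB _.
  exact/slice_iso_sym/to_small_iso.
apply/eqmodP/asboolP; apply: slice_iso_trans (to_small_iso B).
by apply: slice_iso_trans iAB; apply/slice_iso_sym/to_small_iso.
Qed.

Lemma class_reprK (c : burnside) : iso_class (class_repr c) = c.
Proof.
rewrite -[RHS](reprK (c : {eq_quot small_equiv})); apply/eqmodP/asboolP.
exact/slice_iso_sym/to_small_iso.
Qed.

Lemma iso_class_repr A : slice_iso (class_repr (iso_class A)) A.
Proof. exact/iso_classP/class_reprK. Qed.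

Lemma burnside_ind (P : burnside -> Prop) :
  (forall A, P (iso_class A)) -> forall c, P c.
Proof. by move=> Pc c; rewrite -(class_reprK c). Qed.

Definition slice_sum (A B : slice X) : slice X := Slice (gmap_sum (sproj A) (sproj B)).

Definition slice_empty : slice X :=
  @Slice G X (gset_empty G)
    (@GMap G (gset_empty G) X (fun x : void => match x with end)
       (fun _ (x : void) => match x with end)).

Section Fibered.
Variables A B : slice X.

Definition fib_type : finType := {p : A * B | sproj A p.1 == sproj B p.2}.

Lemma fib_act_subproof (g : G) (p : fib_type) :
  sproj A (g *> (val p).1) == sproj B (g *> (val p).2).
Proof. by rewrite !gmapE (eqP (valP p)). Qed.

Definition fib_act (g : G) (p : fib_type) : fib_type :=
  exist _ (g *> (val p).1, g *> (val p).2) (fib_act_subproof g p).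

Lemma fib_act1 p : fib_act 1 p = p.
Proof. by apply/val_inj; case: p => -[a b] ? /=; rewrite !gact1. Qed.

Lemma fib_actM g g' p : fib_act (g * g') p = fib_act g (fib_act g' p).
Proof. by apply/val_inj; rewrite /= !gactM. Qed.

Definition fib_gset : gset G := GSet fib_act1 fib_actM.

Lemma fib_projE g (p : fib_gset) : sproj A (val (g *> p)).1 = g *> sproj A (val p).1.
Proof. exact: gmapE. Qed.

Definition slice_prod : slice X :=
  @Slice G X fib_gset (@GMap G fib_gset X (fun p => sproj A (val p).1) fib_projE).

End Fibered.

Lemma slice_sum_iso A A' B B' :
  slice_iso A A' -> slice_iso B B' -> slice_iso (slice_sum A B) (slice_sum A' B').
Proof.
case=> f [f' [fK f'K]] [k [k' [kK k'K]]].
apply: (@slice_isoI _ _ (slice_sum A B) (slice_sum A' B')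
  (fun u => match u with inl a => inl (f a) | inr b => inr (k b) end)
  (fun u => match u with inl a => inl (f' a) | inr b => inr (k' b) end)).
- by move=> g [a|b] /=; rewrite gmapE.
- by move=> [a|b] /=; rewrite hom_proj.
- by move=> [a|b] /=; rewrite ?fK ?kK.
- by move=> [a|b] /=; rewrite ?f'K ?k'K.
Qed.

Lemma fib_map_subproof A A' B B' (f : slice_hom A A') (k : slice_hom B B')
  (p : slice_prod A B) : sproj A' (f (val p).1) == sproj B' (k (val p).2).
Proof. by rewrite !hom_proj (eqP (valP p)). Qed.

Definition fib_map A A' B B' (f : slice_hom A A') (k : slice_hom B B')
  (p : slice_prod A B) : slice_prod A' B' :=
  exist _ (f (val p).1, k (val p).2) (fib_map_subproof f k p).

Lemma slice_prod_iso A A' B B' :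
  slice_iso A A' -> slice_iso B B' -> slice_iso (slice_prod A B) (slice_prod A' B').
Proof.
case=> f [f' [fK f'K]] [k [k' [kK k'K]]].
apply: (@slice_isoI _ _ (slice_prod A B) (slice_prod A' B')
  (fib_map f k) (fib_map f' k')).
- by move=> g p; apply/val_inj; rewrite /= !gmapE.
- by move=> p /=; rewrite hom_proj.
- by move=> [[a b] ?]; apply/val_inj; rewrite /= fK kK.
- by move=> [[a b] ?]; apply/val_inj; rewrite /= f'K k'K.
Qed.

Definition burnside_add (c d : burnside) : burnside :=
  iso_class (slice_sum (class_repr c) (class_repr d)).
Definition burnside_zero : burnside := iso_class slice_empty.
Definition burnside_mul (c d : burnside) : burnside :=
  iso_class (slice_prod (class_repr c) (class_repr d)).
Definition burnside_one : burnside := iso_class (slice_id X).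

Lemma burnside_addE A B :
  burnside_add (iso_class A) (iso_class B) = iso_class (slice_sum A B).
Proof. by apply/iso_classP/slice_sum_iso; apply: iso_class_repr. Qed.

Lemma burnside_mulE A B :
  burnside_mul (iso_class A) (iso_class B) = iso_class (slice_prod A B).
Proof. by apply/iso_classP/slice_prod_iso; apply: iso_class_repr. Qed.

Lemma burnside_addA : associative burnside_add.
Proof.
elim/burnside_ind=> A; elim/burnside_ind=> B; elim/burnside_ind=> C.
rewrite !burnside_addE; apply/iso_classP.
apply: (@slice_isoI _ _ (slice_sum A (slice_sum B C)) (slice_sum (slice_sum A B) C)
  (fun u => match u with
     | inl a => inl (inl a) | inr (inl b) => inl (inr b) | inr (inr c) => inr c end)
  (fun u => match u with
     | inl (inl a) => inl a | inl (inr b) => inr (inl b) | inr c => inr (inr c) end)).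
- by move=> g [a|[b|c]].
- by move=> [a|[b|c]].
- by move=> [a|[b|c]].
- by move=> [[a|b]|c].
Qed.

Lemma burnside_addC : commutative burnside_add.
Proof.
elim/burnside_ind=> A; elim/burnside_ind=> B; rewrite !burnside_addE; apply/iso_classP.
apply: (@slice_isoI _ _ (slice_sum A B) (slice_sum B A)
  (fun u => match u with inl a => inr a | inr b => inl b end)
  (fun u => match u with inl a => inr a | inr b => inl b end)).
- by move=> g [].
- by case.
- by case.
- by case.
Qed.

Lemma burnside_add0 : left_id burnside_zero burnside_add.
Proof.
elim/burnside_ind=> A; rewrite burnside_addE; apply/iso_classP.
apply: (@slice_isoI _ _ (slice_sum slice_empty A) A
  (fun u => match u with inl x => match x with end | inr a => a end) inr).
- by move=> g [[]|].
- by move=> [[]|].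
- by move=> [[]|].
- by [].
Qed.

Lemma burnside_mulC : commutative burnside_mul.
Proof.
elim/burnside_ind=> A; elim/burnside_ind=> B; rewrite !burnside_mulE; apply/iso_classP.
have sw A' B' (p : slice_prod A' B') : sproj B' (val p).2 == sproj A' (val p).1.
  by rewrite eq_sym (valP p).
pose s A' B' (p : slice_prod A' B') : slice_prod B' A' :=
  exist _ ((val p).2, (val p).1) (sw _ _ p).
apply: (@slice_isoI _ _ (slice_prod A B) (slice_prod B A) (s A B) (s B A)).
- by move=> g p; apply/val_inj.
- by move=> p /=; apply/eqP/sw.
- by move=> [[a b] ?]; apply/val_inj.
- by move=> [[a b] ?]; apply/val_inj.
Qed.

Lemma burnside_mul1 : left_id burnside_one burnside_mul.
Proof.
elim/burnside_ind=> A; rewrite burnside_mulE; apply/iso_classP.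
apply: (@slice_isoI _ _ (slice_prod (slice_id X) A) A
  (fun p => (val p).2) (fun a => exist _ (sproj A a, a) (eqxx _))).
- by [].
- by move=> p /=; rewrite -(eqP (valP p)).
- by move=> [[x a] p]; apply/val_inj; rewrite /= -(eqP p).
- by [].
Qed.

Lemma burnside_mul0 : left_zero burnside_zero burnside_mul.
Proof.
elim/burnside_ind=> A; rewrite burnside_mulE; apply/iso_classP.
apply: (@slice_isoI _ _ (slice_prod slice_empty A) slice_empty
  (fun p => (val p).1) (fun x : void => match x with end)).
- by move=> g [[[]]].
- by move=> [[[]]].
- by move=> [[[]]].
- by case.
Qed.

Lemma burnside_mulDl : left_distributive burnside_mul burnside_add.
Proof.
elim/burnside_ind=> A; elim/burnside_ind=> B; elim/burnside_ind=> C.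
rewrite !(burnside_mulE, burnside_addE); apply/iso_classP.
pose AB := slice_sum A B; pose AC := slice_prod A C; pose BC := slice_prod B C.
have iP (u : slice_sum AC BC) :
    sproj AB (match u with inl p => inl (val p).1 | inr p => inr (val p).1 end)
    == sproj C (match u with inl p => (val p).2 | inr p => (val p).2 end).
  by case: u => p /=; apply: (valP p).
apply: slice_iso_sym.
pose h (u : slice_sum AC BC) : slice_prod AB C := exist _ (_, _) (iP u).
pose k (p : slice_prod AB C) : slice_sum AC BC :=
  match p with
  | exist (inl a, c) e => inl (exist _ (a, c) e)
  | exist (inr b, c) e => inr (exist _ (b, c) e) end.
apply: (@slice_isoI _ _ (slice_sum AC BC) (slice_prod AB C) h k).
- by move=> g [p|p]; apply/val_inj.
- by move=> [p|p].
- by move=> [[[a c] e]|[[a c] e]] /=; congr (_ _); apply/val_inj.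
- by move=> [[[a|b] c] e]; apply/val_inj.
Qed.

Lemma burnside_mulA : associative burnside_mul.
Proof.
elim/burnside_ind=> A; elim/burnside_ind=> B; elim/burnside_ind=> C.
rewrite !burnside_mulE; apply/iso_classP.
pose AB := slice_prod A B; pose BC := slice_prod B C.
have e1 (p : slice_prod A BC) : sproj A (val p).1 == sproj B (val (val p).2).1.
  exact: (valP p).
pose h1 p : AB := exist _ (_, _) (e1 p).
have e2 (p : slice_prod A BC) : sproj AB (h1 p) == sproj C (val (val p).2).2.
  by rewrite /= (eqP (e1 p)) (valP (val p).2).
pose h p : slice_prod AB C := exist _ (_, _) (e2 p).
have e3 (p : slice_prod AB C) : sproj B (val (val p).1).2 == sproj C (val p).2.
  by rewrite -(eqP (valP (val p).1)) (valP p).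
pose k1 p : BC := exist _ (_, _) (e3 p).
have e4 (p : slice_prod AB C) : sproj A (val (val p).1).1 == sproj BC (k1 p).
  exact: (valP (val p).1).
pose k p : slice_prod A BC := exist _ (_, _) (e4 p).
apply: (@slice_isoI _ _ (slice_prod A BC) (slice_prod AB C) h k).
- by move=> g p; apply/val_inj; congr (_, _); apply/val_inj.
- by [].
- by move=> [[a [[b c] ?]] ?]; apply/val_inj; congr (_, _); apply/val_inj.
- by move=> [[[[a b] ?] c] ?]; apply/val_inj; congr (_, _); apply/val_inj.
Qed.

HB.instance Definition _ :=
  GRing.isNmodule.Build burnside burnside_addA burnside_addC burnside_add0.
HB.instance Definition _ :=
  GRing.Nmodule_isComPzSemiRing.Build burnside
    burnside_mulA burnside_mulC burnside_mul1 burnside_mulDl burnside_mul0.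

End Burnside.

Section BurnsideMaps.
Variables (X Y : cell0) (f : cell1 X Y).

Definition burnside_star (c : burnside Y) : burnside X :=
  iso_class (star_obj f (class_repr c)).
Definition burnside_plus (c : burnside X) : burnside Y :=
  iso_class (plus_obj f (class_repr c)).
Definition burnside_bullet (c : burnside X) : burnside Y :=
  iso_class (bullet_obj f (class_repr c)).

Lemma burnside_starE B : burnside_star (iso_class B) = iso_class (star_obj f B).
Proof. exact/iso_classP/star_iso/iso_class_repr. Qed.

Lemma burnside_plusE A : burnside_plus (iso_class A) = iso_class (plus_obj f A).
Proof. exact/iso_classP/plus_iso/iso_class_repr. Qed.

Lemma burnside_bulletE A : burnside_bullet (iso_class A) = iso_class (bullet_obj f A).
Proof. exact/iso_classP/bullet_iso/iso_class_repr. Qed.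

End BurnsideMaps.

Local Close Scope group_scope.
Local Open Scope ring_scope.
Import GRing.Theory.

Section K0.
Variable A : nmodType.

Definition K0_rel (p q : A * A) : bool :=
  `[< exists c, p.1 + q.2 + c = q.1 + p.2 + c >].

Lemma K0_refl : reflexive K0_rel.
Proof. by move=> p; apply/asboolP; exists 0. Qed.

Lemma K0_sym : symmetric K0_rel.
Proof. by move=> p q; apply/asboolP/asboolP => -[c e]; exists c. Qed.

Lemma K0_trans : transitive K0_rel.
Proof.
move=> q p r /asboolP[c e] /asboolP[d e']; apply/asboolP.
exists (q.1 + q.2 + c + d).
transitivity ((p.1 + q.2 + c) + (q.1 + r.2 + d)).
  by rewrite [RHS](AC (3*3) ((1*5)*(4*2*3*6)))/=.
by rewrite e e' [LHS](AC (3*3) ((4*2)*(1*5*3*6)))/=.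
Qed.

Canonical K0_equiv := EquivRel K0_rel K0_refl K0_sym K0_trans.

Definition K0 : Type := {eq_quot K0_equiv}.
HB.instance Definition _ := Choice.on K0.

(* K0_sub a b is kappa a - kappa b.                                           *)
Definition K0_sub (a b : A) : K0 := \pi_({eq_quot K0_equiv}) (a, b).

Definition kappa (a : A) : K0 := K0_sub a 0.

Lemma K0_subP a b a' b' :
  K0_sub a b = K0_sub a' b' <-> exists c, a + b' + c = a' + b + c.
Proof. by split=> [/eqmodP/asboolP|?]; last apply/eqmodP/asboolP. Qed.

Lemma K0_ind (P : K0 -> Prop) : (forall a b, P (K0_sub a b)) -> forall u, P u.
Proof. by move=> Pab; apply: quotW => -[a b]; apply: Pab. Qed.

Definition K0_lift (T : Type) (F : A -> A -> T) (u : K0) : T :=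
  let p := repr (u : {eq_quot K0_equiv}) in F p.1 p.2.

Lemma K0_liftE (T : Type) (F : A -> A -> T) a b :
    (forall a b a' b' c, a + b' + c = a' + b + c -> F a b = F a' b') ->
  K0_lift F (K0_sub a b) = F a b.
Proof.
move=> FE; have: K0_sub (repr (K0_sub a b : {eq_quot K0_equiv})).1
    (repr (K0_sub a b : {eq_quot K0_equiv})).2 = K0_sub a b.
  by rewrite {1}/K0_sub -surjective_pairing; apply: reprK.
by case/K0_subP=> c; apply: FE.
Qed.

Lemma K0_lift2E (T : Type) (F : A -> A -> A -> A -> T) a b c d :
    (forall a b a' b' c d x, a + b' + x = a' + b + x -> F a b c d = F a' b' c d) ->
    (forall a b c d c' d' x, c + d' + x = c' + d + x -> F a b c d = F a b c' d') ->
  K0_lift (fun a b => K0_lift (F a b) (K0_sub c d)) (K0_sub a b) = F a b c d.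
Proof.
move=> F1 F2; rewrite K0_liftE => [|{}a {}b a' b' x e].
  by rewrite K0_liftE // => k l k' l' y; apply: F2.
rewrite K0_liftE => [|k l k' l' y]; last exact: F2.
rewrite K0_liftE => [|k l k' l' y]; last exact: F2.
exact: F1 e.
Qed.

Definition K0_add (u v : K0) : K0 :=
  K0_lift (fun a b => K0_lift (fun c d => K0_sub (a + c) (b + d)) v) u.

Definition K0_opp (u : K0) : K0 := K0_lift (fun a b => K0_sub b a) u.

Lemma K0_addE a b c d : K0_add (K0_sub a b) (K0_sub c d) = K0_sub (a + c) (b + d).
Proof.
apply: K0_lift2E => {}a {}b => [a' b' {}c {}d x e|{}c {}d c' d' x e];
  apply/K0_subP; exists x.
  by rewrite (AC (2*2*1) ((1*3*5)*(2*4)))/= e [RHS](AC (2*2*1) ((1*3*5)*(2*4))).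
by rewrite (AC (2*2*1) ((1*3)*(2*4*5)))/= e [RHS](AC (2*2*1) ((1*3)*(2*4*5))).
Qed.

Lemma K0_oppE a b : K0_opp (K0_sub a b) = K0_sub b a.
Proof.
rewrite /K0_opp K0_liftE // => {}a {}b a' b' x e; apply/K0_subP; exists x.
by rewrite (addrC b) -e (addrC b').
Qed.

Lemma K0_addA : associative K0_add.
Proof.
elim/K0_ind=> a b; elim/K0_ind=> c d; elim/K0_ind=> a' b'.
by rewrite !K0_addE !addrA.
Qed.

Lemma K0_addC : commutative K0_add.
Proof.
by elim/K0_ind=> a b; elim/K0_ind=> c d; rewrite !K0_addE (addrC a) (addrC b).
Qed.

Lemma K0_add0 : left_id (kappa 0) K0_add.
Proof. by elim/K0_ind=> a b; rewrite K0_addE !add0r. Qed.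

Lemma K0_addN : left_inverse (kappa 0) K0_opp K0_add.
Proof.
elim/K0_ind=> a b; rewrite K0_oppE K0_addE; apply/K0_subP; exists 0.
by rewrite !addr0 add0r addrC.
Qed.

HB.instance Definition _ :=
  GRing.isZmodule.Build K0 K0_addA K0_addC K0_add0 K0_addN.

End K0.

Section K0Ring.
Variable A : comPzSemiRingType.
Local Notation K0A := (K0 A).
Implicit Types (a b c d : A) (u v : K0A).

Definition K0_mul u v : K0A :=
  K0_lift (fun a b => K0_lift (fun c d => K0_sub (a * c + b * d) (a * d + b * c)) v) u.

Lemma K0_mulE a b c d :
  K0_mul (K0_sub a b) (K0_sub c d) = K0_sub (a * c + b * d) (a * d + b * c).
Proof.
apply: K0_lift2E => {}a {}b => [a' b' {}c {}d x e|{}c {}d c' d' x e];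
  apply/K0_subP.
  exists (x * c + x * d).
  transitivity ((a + b' + x) * c + (a' + b + x) * d).
    by rewrite !mulrDl [LHS](AC (2*2*2) ((1*4*5)*(3*2*6))).
  by rewrite e -[in X in _ + X]e !mulrDl [LHS](AC (3*3) ((1*5)*(4*2)*(3*6))).
exists (a * x + b * x).
transitivity (a * (c + d' + x) + b * (c' + d + x)).
  by rewrite !mulrDr [LHS](AC (2*2*2) ((1*3*5)*(4*2*6))).
by rewrite e -[in X in _ + X]e !mulrDr [LHS](AC (3*3) ((1*5)*(2*4)*(3*6))).
Qed.

Lemma K0_mulA : associative K0_mul.
Proof.
elim/K0_ind=> a b; elim/K0_ind=> c d; elim/K0_ind=> k l.
rewrite !K0_mulE; congr K0_sub; rewrite !(mulrDl, mulrDr) !mulrA.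
  by rewrite [LHS](AC (2*2) (1*4*2*3)) [RHS](AC (2*2) (1*2*3*4)).
by rewrite [LHS](AC (2*2) (1*4*2*3)) [RHS](AC (2*2) (1*2*3*4)).
Qed.

Lemma K0_mulC : commutative K0_mul.
Proof.
elim/K0_ind=> a b; elim/K0_ind=> c d; rewrite !K0_mulE.
by rewrite (mulrC c a) (mulrC d b) (mulrC c b) (mulrC d a) [b * c + _]addrC.
Qed.

Lemma K0_mul1 : left_id (kappa (1 : A)) K0_mul.
Proof. by elim/K0_ind=> a b; rewrite K0_mulE !mul1r !mul0r !addr0. Qed.

Lemma K0_mulDl : left_distributive K0_mul (@K0_add A).
Proof.
elim/K0_ind=> a b; elim/K0_ind=> c d; elim/K0_ind=> k l.
rewrite !(K0_mulE, K0_addE); congr K0_sub; rewrite !mulrDl; exact: addrACA.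
Qed.

HB.instance Definition _ :=
  GRing.Zmodule_isComPzRing.Build K0A K0_mulA K0_mulC K0_mul1 K0_mulDl.

End K0Ring.

Definition deviation (A : nmodType) (M : zmodType) (phi : A -> M) (n : nat)
    (a : 'I_n -> A) (x : A) : M :=
  \sum_(k < n.+1) \sum_(I : {set 'I_n} | #|I| == k)
    phi (x + \sum_(i in I) a i) *~ (-1) ^+ (n - k).

Definition is_polynomial (A : nmodType) (M : zmodType) (phi : A -> M) : Prop :=
  (forall x, phi x = 0) \/
  exists2 n, (0 < n)%N & forall (a : 'I_n -> A) x, deviation phi a x = 0.

Definition is_polynomial_ext (A B : nmodType) (phi : A -> B) (F : K0 A -> K0 B) : Prop :=
  is_polynomial F /\ forall a, F (kappa a) = kappa (phi a).

(* Definite description of the polynomial extension, which exists and is      *)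
(* unique when phi is polynomial; the value fun=> 0 is otherwise irrelevant.  *)
Definition polynomial_ext (A B : nmodType) (phi : A -> B) : K0 A -> K0 B :=
  xget (fun=> 0) [set F | is_polynomial_ext phi F]%classic.

Definition Omega (X : cell0) : comPzRingType := K0 (burnside X).

Section OmegaMaps.
Variables (X Y : cell0) (f : cell1 X Y).

Definition Omega_star : Omega Y -> Omega X := polynomial_ext (burnside_star f).
Definition Omega_plus : Omega X -> Omega Y := polynomial_ext (burnside_plus f).
Definition Omega_bullet : Omega X -> Omega Y := polynomial_ext (burnside_bullet f).

End OmegaMaps.

(* Main.v *)
Require Import Defs.
From mathcomp Require Import all_boot all_algebra all_fingroup.
From mathcomp Require Import boolp.
From mathcomp Require classical_sets.
(* This import comes last so that gactM is the law of gset and not that of group actions. *)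
Import Defs.

(** A 0-cell X/G is the action groupoid of X; a 1-cell is a functor between
    such groupoids, a 2-cell a natural transformation, and an object of the
    slice category over X a functor from the groupoid to finite sets.  In these
    terms f^* is restriction along f, f_+ is left Kan extension and f_bullet is
    right Kan extension.  The theorem then splits into facts on Kan extensions,
    which hold for isomorphism classes of slices, and their transfer to the
    group completions, which is a matter of polynomial maps.

    Kan extensions.  A map u : A -> L over f exhibits L as f_+ A exactly when it
    is full and essentially surjective on action groupoids (is_lan, lan_iso).
    This condition involves elements only, so it is easily seen to be stable
    under composition of 1-cells, under 2-cells, under sums and under base
    change along iso-comma squares (lan_base_change).  Right Kan extensions are
    handled by their universal property (is_ran), which bullet_obj satisfies
    with counit zeta (bullet_is_ran).  Composition and 2-cells are formal, base
    change is the adjoint mate of base change for f_+ in the transposed square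
    (ran_base_change), and the exponential formula holds because its two sides
    have the same universal property: a map from f^* T to the composite
    B -> A -> X is a map s from f^* T to A together with a lift of s to B, and s
    corresponds to a map from T to P (exp_is_ran).

    Limits in the 2-category.  Testing a bipullback on the one-point groupoid
    shows that it is equivalent to the iso-comma groupoid (bipullback_comma).
    Comparing a bicoproduct of X1/G1 and X2/G2 with an explicit groupoid over
    G1 * G2 shows that its two inclusions are fully faithful, disjoint and
    jointly essentially surjective (bicoproduct_summand).  Hence
    u |-> (i1^* u, i2^* u) has the inverse (u, v) |-> i1_+ u + i2_+ v, and the
    sum given by the Mackey structure is the sum of the ring.

    Polynomial maps.  Moebius inversion turns the deviations of a map phi into
    the coefficients of phi (x + a_I) as a sum over the subsets of I.  Composites
    of polynomial maps are polynomial (pol_comp), and a polynomial map on a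
    monoid extends uniquely to the group completion (pol_K0_ext, pol_K0_inj), so
    two polynomial maps on Omega agree as soon as they agree on isomorphism
    classes.  Restriction and f_+ are additive.  A point of f_bullet is a
    section over a fibre; it has at most |X| |H| values, so it meets boundedly
    many summands of a sum, and f_bullet is polynomial (burnside_bullet_pol). *)

Set Implicit Arguments.
Unset Strict Implicit.
Unset Printing Implicit Defensive.

Local Open Scope ring_scope.
Import GRing.Theory.

(** * Moebius inversion on finite sets *)

Section Moebius.
Variables (T : finType) (M : zmodType).
Implicit Types (c m : {set T} -> M) (S : {set T}).

Lemma sum_subset_setU1 (j : T) S c : j \notin S ->
  \sum_(K : {set T} | K \subset j |: S) c K =
    \sum_(K : {set T} | K \subset S) c K + \sum_(K : {set T} | K \subset S) c (j |: K).
Proof.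
move=> jS; rewrite (bigID (fun K : {set T} => j \in K)) /= addrC; congr (_ + _).
  apply: eq_bigl => K; apply/andP/idP => [[KjS jK]|KS].
    by rewrite -(setU1K jS) subsetD1 KjS jK.
  by rewrite (subset_trans KS (subsetUr _ _)); split=> //; apply: contra jS; apply/subsetP.
rewrite (reindex_onto (fun K => j |: K) (fun K => K :\ j)) /=; last first.
  by move=> K /andP[_ jK]; rewrite setD1K.
apply: eq_bigl => K; rewrite setU11 andbT; apply/andP/idP => [[KjS /eqP <-]|KS].
  by apply/subsetP=> i /setD1P[ij iK]; have /setU1P[/eqP|] := subsetP KjS _ iK;
    rewrite ?(negPf ij).
rewrite setUS // setU1K //; apply: contra jS; exact/subsetP.
Qed.

Definition moebius c S : M :=
  \sum_(K : {set T} | K \subset S) c K *~ (-1) ^+ (#|S| - #|K|).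

Lemma moebius_setU1 (j : T) S c : j \notin S ->
  moebius c (j |: S) = moebius (fun K => c (j |: K) - c K) S.
Proof.
move=> jS; rewrite /moebius sum_subset_setU1 // -big_split; apply: eq_bigr => K KS /=.
have jK : j \notin K by apply: contra jS; apply/subsetP.
rewrite !cardsU1 jS jK /= !add1n subSS subSn ?subset_leq_card // exprS.
by rewrite mulN1r mulrNz mulrzBl addrC.
Qed.

(** The summatory relation is only asked on the subsets of [S]: in the induction on
    [S] the coefficients are shifted by an element that those subsets avoid. *)
Lemma moebius_inversion c m S :
    (forall K : {set T}, K \subset S -> c K = \sum_(J : {set T} | J \subset K) m J) ->
  moebius c S = m S.
Proof.
move: {2}#|S| (erefl #|S|) => n; elim: n => [|n IHn] in S c m *.
  move/eqP; rewrite cards_eq0 => /eqP -> cm.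
  rewrite /moebius (big_pred1 set0) => [|K]; last by rewrite subset0.
  rewrite subnn mulr1z cm // (big_pred1 set0) // => K; exact: subset0.
move=> Sn; have /card_gt0P[j jS] : (0 < #|S|)%N by rewrite Sn.
rewrite -(setD1K jS) => cm; rewrite moebius_setU1 ?setD11 //.
apply: (IHn _ _ (fun K => m (j |: K))) => [|K KS].
  by apply/eqP; rewrite -eqSS -Sn (cardsD1 j S) jS.
have jK : j \notin K by apply/negP=> /(subsetP KS); rewrite setD11.
have KjS : K \subset j |: (S :\ j) := subset_trans KS (subsetUr _ _).
by rewrite !cm ?setUS // sum_subset_setU1 // addrC addKr.
Qed.

Lemma sum_moebius c S : c S = \sum_(J : {set T} | J \subset S) moebius c J.
Proof.
move: {2}#|S| (erefl #|S|) => n; elim: n => [|n IHn] in S c *.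
  move/eqP; rewrite cards_eq0 => /eqP ->.
  rewrite (big_pred1 set0) => [|K]; last by rewrite subset0.
  rewrite /moebius (big_pred1 set0) => [|K]; last by rewrite subset0.
  by rewrite subnn mulr1z.
move=> Sn; have /card_gt0P[j jS] : (0 < #|S|)%N by rewrite Sn.
have e : #|S :\ j| = n by apply/eqP; rewrite -eqSS -Sn (cardsD1 j S) jS.
rewrite -(setD1K jS) sum_subset_setU1 ?setD11 // -IHn //.
rewrite (eq_bigr (moebius (fun K => c (j |: K) - c K))) => [|K KS].
  by rewrite -IHn // addrCA subrr addr0.
by rewrite moebius_setU1 //; apply/negP=> /(subsetP KS); rewrite setD11.
Qed.

End Moebius.

(** * Polynomial maps *)

Section Polynomial.
Variables (A : nmodType) (M : zmodType).
Implicit Types (phi : A -> M) (a x : A).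

Definition diff a phi : A -> M := fun x => phi (x + a) - phi x.

(** [pol n] is polynomiality of degree less than [n], by recursion on the degree;
    this form makes inductions on the degree immediate. *)
Fixpoint pol n phi : Prop :=
  if n is n'.+1 then forall a, pol n' (diff a phi) else forall x, phi x = 0.

Lemma polW n phi : pol n phi -> pol n.+1 phi.
Proof.
elim: n phi => [|n IHn] phi p a; last exact/IHn/p.
by move=> x; rewrite /diff !p subrr.
Qed.

Lemma pol_le m n phi : (m <= n)%N -> pol m phi -> pol n phi.
Proof. by move=> /subnK <-; elim: (n - m)%N => //= k IHk /IHk; apply: polW. Qed.

Lemma polB n phi psi : pol n phi -> pol n psi -> pol n (fun x => phi x - psi x).
Proof.
elim: n phi psi => [|n IHn] phi psi p q a /=; first by rewrite p q subrr.
have -> : diff a (fun x => phi x - psi x) = (fun x => diff a phi x - diff a psi x).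
  by apply/funext=> x; rewrite /diff !opprB addrACA [- psi _ + _]addrC addrACA.
by apply: IHn; [apply: p | apply: q].
Qed.

Lemma pol_shift n phi y : pol n phi -> pol n (fun x => phi (x + y)).
Proof.
elim: n phi => [|n IHn] phi p a /=; first exact: p.
have -> : diff a (fun x => phi (x + y)) = (fun x => diff a phi (x + y)).
  by apply/funext=> x; rewrite /diff addrAC.
exact/IHn/p.
Qed.

Lemma pol_seq n phi :
  pol n phi <->
  (forall s : seq A, size s = n -> forall x, foldl (fun p a => diff a p) phi s x = 0).
Proof.
elim: n phi => [|n IHn] phi; split=> [p s|p x].
- by move/size0nil=> ->; exact: p.
- exact: (p [::]).
- by case: s => // a s [sn]; apply: (IHn (diff a phi)).1.
- by apply/IHn => s sn; apply: (p (x :: s)); rewrite /= sn.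
Qed.

(** The values of [phi] at the vertices of the parallelepiped with origin [x] and
    edges [a i], a vertex being the set of the edges that lead to it. *)
Definition cube phi (T : finType) (a : T -> A) x (S : {set T}) : M :=
  phi (x + \sum_(i in S) a i).

(** Splitting off one edge of a parallelepiped is taking one difference, hence the
    Moebius transform of a cube is an iterated difference. *)
Lemma moebius_cube (T : finType) (a : T -> A) phi (r : seq T) x : uniq r ->
  moebius (cube phi a x) [set i in r] = foldl (fun p b => diff b p) phi (map a r) x.
Proof.
elim: r phi => [|j r IHr] phi /=.
  move=> _; rewrite set_nil /moebius (big_pred1 set0) => [|K]; last by rewrite subset0.
  by rewrite subnn mulr1z /cube big_set0 addr0.
case/andP=> jr ur; rewrite set_cons moebius_setU1 ?inE // -IHr //.
apply: eq_bigr => K Kr; congr (_ *~ _); rewrite /cube /diff big_setU1 /=.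
  by rewrite addrA [x + _ + _]addrAC.
by apply: contra jr => /(subsetP Kr); rewrite inE.
Qed.

Lemma pol_moebius n phi (T : finType) (a : T -> A) x (J : {set T}) :
  pol n phi -> (n <= #|J|)%N -> moebius (cube phi a x) J = 0.
Proof.
move=> p nJ; have -> : J = [set i in enum J] by apply/setP=> i; rewrite inE mem_enum.
rewrite moebius_cube ?enum_uniq //; apply: (pol_seq #|J| phi).1; first exact: pol_le p.
by rewrite size_map -cardE.
Qed.

Lemma pol_of_moebius n phi :
  (forall (a : 'I_n -> A) x, moebius (cube phi a x) setT = 0) -> pol n phi.
Proof.
move=> p; apply/pol_seq => s sn x.
have := p (fun i => nth 0 s i) x.
have -> : [set: 'I_n] = [set i in enum 'I_n] by apply/setP=> i; rewrite !inE mem_enum.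
rewrite moebius_cube ?enum_uniq // map_comp val_enum_ord -[in iota _ _]sn.
by rewrite -/(mkseq _ _) mkseq_nth.
Qed.

Lemma deviation_moebius n phi (a : 'I_n -> A) x :
  deviation phi a x = moebius (cube phi a x) setT.
Proof.
rewrite /moebius (eq_bigl predT) => [|K]; last by rewrite subsetT.
rewrite (partition_big (fun K : {set 'I_n} => inord #|K| : 'I_n.+1) predT) //=.
apply: eq_bigr => k _; apply: congr_big => // K; last first.
  by move=> /eqP Kk; rewrite cardsT card_ord Kk.
rewrite -val_eqE /= inordK // ltnS; apply: leq_trans (max_card _) _.
by rewrite card_ord.
Qed.

Lemma is_polynomialP phi : is_polynomial phi <-> exists n, pol n phi.
Proof.
split=> [[p|[n _ p]]|[n p]]; first by exists 0.
  by exists n; apply: pol_of_moebius => a x; rewrite -deviation_moebius.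
right; exists n.+1 => // a x; rewrite deviation_moebius.
by apply: pol_moebius p _; rewrite cardsT card_ord.
Qed.

(** Criterion for polynomiality: by uniqueness of Moebius inversion, any expression
    of the cubes as sums over subsets computes the deviations. *)
Lemma pol_of_cube n phi :
    (forall (T : finType) (a : T -> A) x, exists m : {set T} -> M,
       (forall S, cube phi a x S = \sum_(J : {set T} | J \subset S) m J) /\
       (forall J : {set T}, (n <= #|J|)%N -> m J = 0)) ->
  pol n phi.
Proof.
move=> cubes; apply: pol_of_moebius => a x; have [m [mE m0]] := cubes _ a x.
by rewrite (moebius_inversion (fun K _ => mE K)) m0 // cardsT card_ord.
Qed.

Lemma pol_additive phi : {morph phi : x y / x + y} -> pol 2 phi.
Proof.
move=> phiD a b x; rewrite /diff !phiD.
have addC u v : u + v - u = v :> M by rewrite addrC addKr.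
by rewrite !addC subrr.
Qed.

(** A difference in the direction [0] vanishes. *)
Lemma moebius_cube0 (T : finType) (a : T -> A) phi x (J : {set T}) j :
  j \in J -> a j = 0 -> moebius (cube phi a x) J = 0.
Proof.
move=> jJ aj; rewrite -(setD1K jJ) moebius_setU1 ?setD11 //.
apply: big1 => K KJ; have jK : j \notin K by apply/negP=> /(subsetP KJ); rewrite setD11.
by rewrite /cube big_setU1 //= aj add0r subrr mul0rz.
Qed.

End Polynomial.

(** Write the values of [phi] on a cube as sums of coefficients [e J], with [J] of
    less than [n] elements, and expand [psi] of such a sum as a sum over families
    [P] of less than [m] subsets.  Collecting the families with the same union [U]
    expresses [psi \o phi] as a sum over subsets, in which [U] has at most [m * n]
    elements. *)
Lemma pol_comp (A : nmodType) (M N : zmodType) (phi : A -> M) (psi : M -> N) m n :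
  pol n phi -> pol m psi -> pol (m * n).+1 (fun x => psi (phi x)).
Proof.
move=> pn pm; apply: pol_of_cube => T a x.
pose e := moebius (cube phi a x).
exists (fun U => \sum_(P : {set {set T}} | cover P == U) moebius (cube psi e 0) P).
split=> [S|U mnU].
  have -> : cube (fun x => psi (phi x)) a x S = cube psi e 0 (powerset S).
    rewrite /cube add0r -/(cube phi a x S) sum_moebius; congr psi.
    by apply: eq_bigl => J; rewrite powersetE.
  rewrite sum_moebius (partition_big (@cover T) (fun U => U \subset S)) /= => [|P /subsetP PS].
    apply: eq_bigr => U US; apply: eq_bigl => P; apply: andb_idl => /eqP PU.
    apply/subsetP=> J JP; rewrite powersetE; apply: subset_trans US.
    by rewrite -PU; apply: bigcup_sup.
  by apply/bigcupsP => J /PS; rewrite powersetE.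
apply: big1 => P /eqP PU; have [mP|Pm] := leqP m #|P|; first exact: pol_moebius pm mP.
(* A union of few sets is large only if one of them is large. *)
have [J JP nJ] : exists2 J : {set T}, J \in P & (n <= #|J|)%N.
  apply/exists_inP; apply: contraLR mnU; rewrite negb_exists_in => /forall_inP small.
  rewrite -leqNgt -PU; apply: leq_trans (leq_card_cover P).1 _.
  apply: leq_trans (_ : \sum_(J in P) n <= _)%N.
    by apply: leq_sum => J /small; rewrite -ltnNge; apply: ltnW.
  by rewrite sum_nat_const leq_mul2r ltnW ?orbT.
by apply: moebius_cube0 JP _; apply: pol_moebius pn nJ.
Qed.

(** * Extension to the group completion *)

Section K0Extension.
Variable A : nmodType.

Lemma K0_subE (a b : A) : K0_sub a b = kappa a - kappa b.
Proof.
have -> : - kappa b = K0_sub 0 b by apply: K0_oppE.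
have -> : kappa a + K0_sub 0 b = K0_sub (a + 0) (0 + b) by apply: K0_addE.
by rewrite addr0 add0r.
Qed.

Lemma kappaD : {morph @kappa A : a b / a + b}.
Proof.
move=> a b; have -> : kappa a + kappa b = K0_sub (a + b) (0 + 0) by apply: K0_addE.
by rewrite addr0.
Qed.

Lemma kappa0 : kappa (0 : A) = 0.
Proof. by []. Qed.

(** Subtracting [kappa b] from [kappa a] is undone by a difference in the direction
    [kappa b], which has lower degree and also vanishes on the image of [kappa]. *)
Lemma pol_K0_eq0 (N : zmodType) (F : K0 A -> N) n :
  pol n F -> (forall a, F (kappa a) = 0) -> forall u, F u = 0.
Proof.
elim: n F => [|n IHn] F pF F0; first exact: pF.
elim/K0_ind=> a b; apply/oppr_inj; rewrite oppr0.
transitivity (diff (kappa b) F (K0_sub a b)); first by rewrite /diff K0_subE subrK F0 sub0r.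
by apply: IHn (pF _) _ _ => c; rewrite /diff -kappaD !F0 subrr.
Qed.

Lemma pol_K0_inj (N : zmodType) (F F' : K0 A -> N) m n :
    pol m F -> pol n F' -> (forall a, F (kappa a) = F' (kappa a)) -> F =1 F'.
Proof.
move=> pF pF' FF' u; apply/eqP; rewrite -subr_eq0; apply/eqP.
apply: (@pol_K0_eq0 _ (fun u => F u - F' u) (maxn m n)) => [|a].
  by apply: polB; [apply: pol_le pF; apply: leq_maxl | apply: pol_le pF'; apply: leq_maxr].
by rewrite FF' subrr.
Qed.

(** Induction on the degree: the differences of [phi] extend, and they determine
    how much [phi] must change from [a] to [a - b]. *)
Lemma pol_K0_ext (N : zmodType) (phi : A -> N) n :
  pol n phi -> exists2 F : K0 A -> N, pol n F & forall a, F (kappa a) = phi a.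
Proof.
elim: n phi => [|n IHn] phi p.
  by exists (fun=> 0) => // a; rewrite p.
(* E b extends the difference of phi in the direction b. *)
have /choice[E EP] : forall b, exists F : K0 A -> N,
    pol n F /\ forall a, F (kappa a) = diff b phi a.
  by move=> b; have [F] := IHn _ (p b); exists F.
have Epol b : pol n (E b) := (EP b).1.
have Eka b a : E b (kappa a) = phi (a + b) - phi a := (EP b).2 a.
have ED b c u : E (b + c) u = E c (u + kappa b) + E b u.
  apply/eqP; rewrite -subr_eq; apply/eqP; move: u.
  apply: pol_K0_inj (polB (Epol (b + c)) (Epol b)) (pol_shift (kappa b) (Epol c)) _ => a.
  by rewrite -kappaD !Eka addrA opprB addrA subrK.
have diffE b c u : diff (kappa b) (E c) u = diff (kappa c) (E b) u.
  by rewrite /diff; apply/eqP; rewrite subr_eq addrAC eq_sym subr_eq -!ED addrC.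
(* The value at a - b forced by diff (kappa b) F = E b. *)
pose F0 a b := phi a - E b (K0_sub a b).
have F0D a b z : F0 (a + z) (b + z) = F0 a b.
  have e : K0_sub (a + z) (b + z) = K0_sub a b.
    by rewrite !K0_subE !kappaD opprD addrACA subrr addr0.
  rewrite /F0 e ED K0_subE subrK Eka.
  by rewrite opprD opprB addrA subrKC.
have F0E a b a' b' c : a + b' + c = a' + b + c -> F0 a b = F0 a' b'.
  move=> e; rewrite -(F0D a b (b' + c)) -(F0D a' b' (b + c)) !addrA e.
  by rewrite [b + b']addrC.
pose F := K0_lift F0.
have FE a b : F (K0_sub a b) = phi a - E b (K0_sub a b) by apply: K0_liftE F0E.
have Fka a : F (kappa a) = phi a.
  rewrite FE -/(kappa a) Eka addr0 subrr subr0 //.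
exists F => // u.
suff Fb b : diff (kappa b) F = E b.
  elim/K0_ind: u => b c.
  have -> : diff (K0_sub b c) F =
      (fun x => E b (x + - kappa c) - E c (x + - kappa c)).
    apply/funext=> x; rewrite -!Fb /diff K0_subE addrNK -addrA [- kappa c + _]addrC.
    by set P := F (x + _); rewrite opprB addrA subrK.
  by apply: polB; apply: pol_shift.
apply/funext; elim/K0_ind=> a c; rewrite /diff.
have -> : K0_sub a c + kappa b = K0_sub (a + b) c.
  by rewrite !K0_subE kappaD addrAC.
rewrite !FE; have := diffE b c (K0_sub a c); rewrite /diff.
have -> : K0_sub a c + kappa c = kappa a by rewrite K0_subE subrK.
have -> : K0_sub a c + kappa b = K0_sub (a + b) c by rewrite !K0_subE kappaD addrAC.
rewrite Eka => /eqP; rewrite subr_eq => /eqP ->.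
by rewrite !opprD !opprK -!addrA addNKr [- phi a + _]addrC addKr subrKC.
Qed.

End K0Extension.

Section PolynomialExt.
Variables (A B : nmodType) (phi : A -> B).

(** By uniqueness, exhibiting one polynomial extension computes the chosen one. *)
Lemma is_polynomial_extP F n : pol n F -> (forall a, F (kappa a) = kappa (phi a)) ->
  polynomial_ext phi = F.
Proof.
move=> pF FE; apply: classical_sets.xget_unique => [|F' [/is_polynomialP[m pF'] F'E]].
  by split=> //; apply/is_polynomialP; exists n.
by apply/funext; apply: pol_K0_inj pF' pF _ => a; rewrite FE F'E.
Qed.

Lemma polynomial_extP n : pol n (fun a => kappa (phi a)) ->
  pol n (polynomial_ext phi) /\ forall a, polynomial_ext phi (kappa a) = kappa (phi a).
Proof. by case/pol_K0_ext=> F pF FE; rewrite (is_polynomial_extP pF FE). Qed.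

End PolynomialExt.

Local Close Scope ring_scope.
Local Open Scope group_scope.

(** * Left Kan extensions *)

Lemma slice_iso_bij (G : finGroupType) (X : gset G) (A B : slice X) (k : slice_hom A B) :
  injective k -> (forall b, exists a, k a = b) -> slice_iso A B.
Proof.
move=> k_inj /choice[k' k'K]; apply: (slice_isoI (f := k) (f' := k')) => //.
- exact: gmapE.
- exact: hom_proj.
- by move=> a; apply: k_inj; rewrite k'K.
Qed.

Section Lan.
Variables (X Y : cell0) (f : cell1 X Y).

(** A map over [f], that is, the adjoint form of a map from [A] to [star_obj f B]. *)
Record is_lift (A : slice X) (B : slice Y) (u : A -> B) : Prop := IsLift {
  lift_proj : forall a, sproj B (u a) = f (sproj A a);
  lift_act : forall g a, u (g *> a) = c1coc f (sproj A a) g *> u a }.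

(** As a functor between action groupoids, [u] is essentially surjective and full;
    together with the projection of [L] it is then the comprehensive factorization
    of the composite of [f] with the projection of [A]. *)
Record is_lan (A : slice X) (L : slice Y) (u : A -> L) : Prop := IsLan {
  lan_lift :> is_lift u;
  lan_surj : forall l, exists h a, h *> u a = l;
  lan_full : forall h a a', h *> u a = u a' ->
    exists2 g, a' = g *> a & h = c1coc f (sproj A a) g }.

(** The value at [h *> u a] is forced to be [h *> v a]; fullness makes it well
    defined. *)
Lemma lan_univ (A : slice X) (L B : slice Y) (u : A -> L) (v : A -> B) :
  is_lan u -> is_lift v -> exists k : slice_hom L B, forall a, k (u a) = v a.
Proof.
move=> uL vL; have /choice[s sP] l : exists ha : cgrp Y * A, ha.1 *> u ha.2 = l.
  by have [h [a <-]] := lan_surj uL l; exists (h, a).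
have kE h a : (s (h *> u a)).1 *> v (s (h *> u a)).2 = h *> v a.
  have := sP (h *> u a); case: (s _) => h' a' /= e.
  have [|g -> e'] := @lan_full _ _ _ uL (h^-1 * h') a' a; first by rewrite gactM e gactK.
  by rewrite (lift_act vL) -e' -gactM mulKVg.
have kA h l : (s (h *> l)).1 *> v (s (h *> l)).2 = h *> ((s l).1 *> v (s l).2).
  by have [h' [a <-]] := lan_surj uL l; rewrite -gactM !kE gactM.
have kP l : sproj B ((s l).1 *> v (s l).2) = sproj L l.
  have [h' [a <-]] := lan_surj uL l.
  by rewrite kE !gmapE (lift_proj vL) (lift_proj uL).
exists (@SliceHom _ _ L B (GMap kA) kP) => a /=.
by have := kE 1 a; rewrite !gact1.
Qed.

Lemma lan_hom_eq (A : slice X) (L B : slice Y) (u : A -> L) (k k' : slice_hom L B) :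
  is_lan u -> (forall a, k (u a) = k' (u a)) -> k =1 k'.
Proof.
by move=> uL e l; have [h [a <-]] := lan_surj uL l; rewrite !gmapE e.
Qed.

Definition plus_unit (A : slice X) (a : A) : plus_obj f A := bal_class f A 1 a.

Lemma plus_is_lan (A : slice X) : is_lan (@plus_unit A).
Proof.
have actE h h' a : h *> (bal_class f A h' a : plus_obj f A) = bal_class f A (h * h') a.
  exact: bal_actE.
split=> [|l|h a a'].
- split=> [a|g a]; first by rewrite /= bal_mapE sim_funE gact1.
  by rewrite [_ *> plus_unit _]actE mulg1; apply/esym/eqP/bal_classP; exists g; rewrite ?mul1g.
- by elim/bal_ind: l => h a; exists h, a; apply: etrans (actE _ _ _) _; rewrite mulg1.
rewrite [_ *> plus_unit _]actE mulg1 => /eqP/bal_classP[g -> ->]; exists g; rewrite ?mul1g //.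
Qed.

Lemma lan_iso (A : slice X) (L : slice Y) (u : A -> L) :
  is_lan u -> slice_iso (plus_obj f A) L.
Proof.
move=> uL; have pL := plus_is_lan A; have [k kE] := lan_univ pL uL.
apply: (slice_iso_bij (k := k)) => [l l'|l]; last first.
  by have [h [a <-]] := lan_surj uL l; exists (h *> plus_unit a); rewrite gmapE kE.
have [h [a <-]] := lan_surj pL l; have [h' [a' <-]] := lan_surj pL l'.
rewrite !gmapE !kE => e; have [|g -> e'] := @lan_full _ _ _ uL (h'^-1 * h) a a'.
  by rewrite gactM e gactK.
by rewrite (lift_act pL) -e' -gactM mulKVg.
Qed.

End Lan.

Lemma burnside_plus_lan (X Y : cell0) (f : cell1 X Y) (A : slice X) (L : slice Y) (u : A -> L) :
  is_lan f u -> burnside_plus f (iso_class A) = iso_class L.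
Proof. by move/lan_iso=> iL; rewrite burnside_plusE; apply/iso_classP. Qed.

Lemma lan_id (X : cell0) (A : slice X) : is_lan (cell1_id X) (id : A -> A).
Proof. by split=> [|a|h a a' e]; [split | exists 1, a; rewrite gact1 | exists h]. Qed.

Lemma lan_comp (X Y Z : cell0) (f : cell1 X Y) (g : cell1 Y Z)
    (A : slice X) (B : slice Y) (C : slice Z) (u : A -> B) (v : B -> C) :
  is_lan f u -> is_lan g v -> is_lan (g \o1 f) (fun a => v (u a)).
Proof.
move=> uL vL; split=> [|c|h a a' e].
- split=> [a|k a]; first by rewrite (lift_proj vL) (lift_proj uL).
  by rewrite (lift_act uL) (lift_act vL) (lift_proj uL).
- have [h [b <-]] := lan_surj vL c; have [k [a <-]] := lan_surj uL b.
  by exists (h * c1coc g (sproj B (u a)) k), a; rewrite (lift_act vL) gactM.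
have [k ek ->] := lan_full vL e; have [l -> ->] := lan_full uL (esym ek).
by exists l; rewrite ?(lift_proj uL).
Qed.

Lemma lan_cell2 (X Y : cell0) (f f' : cell1 X Y) e (A : slice X) (L : slice Y) (u : A -> L) :
  is_cell2 f f' e -> is_lan f u -> is_lan f' (fun a => e (sproj A a) *> u a).
Proof.
move=> [eM eC] uL; split=> [|l|h a a' ea].
- split=> [a|g a]; first by rewrite gmapE (lift_proj uL) eM.
  by rewrite (lift_act uL) gmapE -eC -!gactM mulgKV.
- have [h [a <-]] := lan_surj uL l; exists (h * (e (sproj A a))^-1), a.
  by rewrite -gactM mulgKV.
have [|g ga eg] := @lan_full _ _ _ _ _ _ uL ((e (sproj A a'))^-1 * h * e (sproj A a)) a a'.
  by rewrite !gactM ea gactK.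
by exists g => //; rewrite -eC -eg ga gmapE !mulgA mulgV mul1g mulgK.
Qed.

Lemma lan_postcomp (G : finGroupType) (V Y : gset G) (p : gmap V Y) (B : slice V) :
  is_lan (X := Cell0 V) (Y := Cell0 Y) (cell1_of_gmap p) (id : B -> slice_postcomp p B).
Proof. by split=> [|b|h b b' e]; [split | exists 1, b; rewrite gact1 | exists h]. Qed.

Lemma burnside_plus_gmap (G : finGroupType) (V Y : gset G) (p : gmap V Y) (B : slice V) :
  burnside_plus (cell1_of_gmap p) (iso_class B) = iso_class (slice_postcomp p B).
Proof. exact: burnside_plus_lan (lan_postcomp p B). Qed.

Lemma lan_sum (X Y : cell0) (f : cell1 X Y) (A A' : slice X) (L L' : slice Y)
    (u : A -> L) (u' : A' -> L') :
    is_lan f u -> is_lan f u' ->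
  is_lan f (fun s : slice_sum A A' =>
              match s with inl a => inl (u a) | inr a => inr (u' a) end : slice_sum L L').
Proof.
move=> uL u'L; split=> [|l|h a a'].
- split=> [[a|a]|g [a|a]] /=; first exact: lift_proj uL _.
  + exact: lift_proj u'L _.
  + by rewrite (lift_act uL).
  + by rewrite (lift_act u'L).
- case: l => l.
    by have [h [a <-]] := lan_surj uL l; exists h, (inl a).
  by have [h [a <-]] := lan_surj u'L l; exists h, (inr a).
case: a a' => a [a'|a'] // [e].
  by have [g -> ->] := lan_full uL e; exists g.
by have [g -> ->] := lan_full u'L e; exists g.
Qed.

Lemma burnside_plus_id (X : cell0) : burnside_plus (cell1_id X) =1 id.
Proof. by elim/burnside_ind=> A; apply: burnside_plus_lan (lan_id A). Qed.

Lemma burnside_plus_comp (X Y Z : cell0) (g : cell1 Y Z) (f : cell1 X Y) :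
  burnside_plus (g \o1 f) =1 burnside_plus g \o burnside_plus f.
Proof.
elim/burnside_ind=> A /=; rewrite (burnside_plus_lan (plus_is_lan f A)).
rewrite (burnside_plus_lan (plus_is_lan g _)).
exact: burnside_plus_lan (lan_comp (plus_is_lan f A) (plus_is_lan g _)).
Qed.

Lemma burnside_plus_cell2 (X Y : cell0) (f f' : cell1 X Y) e :
  is_cell2 f f' e -> burnside_plus f =1 burnside_plus f'.
Proof.
move=> fe; elim/burnside_ind=> A; rewrite (burnside_plus_lan (plus_is_lan f A)).
by rewrite (burnside_plus_lan (lan_cell2 fe (plus_is_lan f A))).
Qed.

Lemma iso_class_sum (G : finGroupType) (X : gset G) (A B : slice X) :
  (iso_class A + iso_class B)%R = iso_class (slice_sum A B).
Proof. exact: burnside_addE. Qed.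

Lemma burnside_plusD (X Y : cell0) (f : cell1 X Y) :
  {morph burnside_plus f : c d / (c + d)%R}.
Proof.
elim/burnside_ind=> A; elim/burnside_ind=> B.
rewrite iso_class_sum !(burnside_plus_lan (plus_is_lan f _)) iso_class_sum.
rewrite -(burnside_plus_lan (plus_is_lan f (slice_sum A B))).
exact: burnside_plus_lan (lan_sum (plus_is_lan f A) (plus_is_lan f B)).
Qed.

(** * Iso-comma squares *)

Section Comma.
Variables (A1 A2 B P : cell0) (f1 : cell1 A1 B) (f2 : cell1 A2 B).
Variables (p1 : cell1 P A1) (p2 : cell1 P A2) (kap : P -> cgrp B).

(** The comparison functor from [P] to the groupoid of triples (x1, x2, b), where b
    is an isomorphism from f1 x1 to f2 x2, is essentially surjective and full. *)
Record is_comma : Prop := IsComma {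
  comma_cell : is_cell2 (f1 \o1 p1) (f2 \o1 p2) kap;
  comma_surj : forall x1 x2 b, f2 x2 = b *> f1 x1 -> exists p g1 g2,
    [/\ g1 *> p1 p = x1, g2 *> p2 p = x2
      & b * c1coc f1 (p1 p) g1 = c1coc f2 (p2 p) g2 * kap p];
  comma_full : forall p p' g1 g2,
    g1 *> p1 p = p1 p' -> g2 *> p2 p = p2 p' ->
    kap p' * c1coc f1 (p1 p) g1 = c1coc f2 (p2 p) g2 * kap p ->
    exists k, [/\ k *> p = p', c1coc p1 p k = g1 & c1coc p2 p k = g2] }.

(** The unit of the pulled back extension is the unit [u] transported along the
    2-cell of the square.  Each of the two conditions on it comes from the
    corresponding condition on [u] and on the square. *)
Lemma lan_base_change (A : slice A2) (L : slice B) (u : A -> L) :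
    is_comma -> is_lan f2 u ->
  exists2 v : star_obj p2 A -> star_obj f1 L, is_lan p1 v
    & forall t, (val (v t)).2 = (kap (val t).1)^-1 *> u (val t).2.
Proof.
case=> [[kM kC] surj full] uL.
have vP (t : star_obj p2 A) :
    f1 (p1 (val t).1) == sproj L ((kap (val t).1)^-1 *> u (val t).2).
  by rewrite gmapE (lift_proj uL) -(eqP (valP t)) [f2 _]kM gactK.
exists (fun t => exist _ (_, _) (vP t)) => //; split=> [|[[x1 l] /= e]|h t t'].
- split=> // g t; apply/val_inj => /=; congr (_, _); first exact: c1mapE.
  rewrite (lift_act uL) -(eqP (valP t)) -!gactM; congr (_ *> _).
  have := kC (val t).1 g; rewrite /= /comp_coc => <-.
  by rewrite !mulgA mulVg mul1g.
- have [h [a ea]] := lan_surj uL l.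
  have [|p [g1 [g2 [e1 e2 e12]]]] := surj x1 (sproj A a) h^-1.
    by rewrite (eqP e) -ea gmapE (lift_proj uL) gactK.
  have tP : p2 p == sproj A (g2^-1 *> a) by rewrite gmapE -e2 gactK.
  exists g1, (exist _ (p, g2^-1 *> a) tP); apply/val_inj; rewrite /= e1 -ea; congr (_, _).
  rewrite (lift_act uL) -!gactM; congr (_ *> _).
  rewrite -e2 c1cocV -[LHS]mulgA -invMg -e12 invMg invgK mulgA mulgV mul1g //.
case: t t' => [[p a] ea] [[p' a'] ea'] [/= e1 e2].
have [|g2 ga eg] := @lan_full _ _ _ _ _ _ uL
    (kap p' * (c1coc f1 (p1 p) h * (kap p)^-1)) a a'.
  by rewrite !gactM e2 gactKV.
have [||k [kp k1 k2]] := full p p' h g2 e1.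
- by rewrite (eqP ea) (eqP ea') ga gmapE.
- by rewrite (eqP ea) -eg !mulgA mulgKV.
by exists k => //; apply/val_inj; rewrite /= kp k2 ga.
Qed.

Lemma burnside_star_plus_comma :
  is_comma -> burnside_star f1 \o burnside_plus f2 =1 burnside_plus p1 \o burnside_star p2.
Proof.
move=> cP; elim/burnside_ind=> A /=; rewrite (burnside_plus_lan (plus_is_lan f2 A)).
have [v vL _] := lan_base_change cP (plus_is_lan f2 A).
by rewrite !burnside_starE (burnside_plus_lan vL).
Qed.

End Comma.

(** * Restriction along a 1-cell *)

Definition star_pt (X Y : cell0) (f : cell1 X Y) (B : slice Y) x b
  (e : f x == sproj B b) : star_obj f B := exist _ (x, b) e.

Section SliceHom.
Variables (G : finGroupType) (X : gset G).
Implicit Types A B C : slice X.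

Definition mk_slice_hom A B (k : A -> B) (kA : forall g a, k (g *> a) = g *> k a)
  (kP : forall a, sproj B (k a) = sproj A a) : slice_hom A B :=
  @SliceHom _ _ A B (GMap kA) kP.

Definition slice_hom_id A : slice_hom A A :=
  @mk_slice_hom A A id (fun _ _ => erefl) (fun=> erefl).

Lemma slice_hom_comp_act A B C (k : slice_hom B C) (k' : slice_hom A B) g a :
  k (k' (g *> a)) = g *> k (k' a).
Proof. by rewrite !gmapE. Qed.

Lemma slice_hom_comp_proj A B C (k : slice_hom B C) (k' : slice_hom A B) a :
  sproj C (k (k' a)) = sproj A a.
Proof. by rewrite !hom_proj. Qed.

Definition slice_hom_comp A B C (k : slice_hom B C) (k' : slice_hom A B) : slice_hom A C :=
  mk_slice_hom (slice_hom_comp_act k k') (slice_hom_comp_proj k k').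

End SliceHom.

Section StarHoms.
Variables (X Y Z : cell0).

Lemma star_map_comp (f : cell1 X Y) (A B C : slice Y) (k : slice_hom B C) (k' : slice_hom A B) t :
  star_map f (slice_hom_comp k k') t = star_map f k (star_map f k' t).
Proof. exact: val_inj. Qed.

Lemma star_map_ext (f : cell1 X Y) (A B : slice Y) (k k' : slice_hom A B) t :
  k =1 k' -> star_map f k t = star_map f k' t.
Proof. by move=> kk'; apply: val_inj; rewrite /= kk'. Qed.

Lemma lift_star (f : cell1 X Y) (A : slice X) (B : slice Y) (k : slice_hom A (star_obj f B)) :
  is_lift f (fun a => (val (k a)).2).
Proof.
have kP a : (val (k a)).1 = sproj A a := hom_proj k a.
by split=> [a|g a]; [rewrite -(eqP (valP (k a))) kP | rewrite gmapE /= kP].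
Qed.

Section LiftHom.
Variables (f : cell1 X Y) (A : slice X) (B : slice Y) (u : A -> B) (uL : is_lift f u).

Lemma lift_hom_subproof a : f (sproj A a) == sproj B (u a).
Proof. by rewrite (lift_proj uL). Qed.

Lemma lift_hom_act g a :
  star_pt (lift_hom_subproof (g *> a)) = g *> star_pt (lift_hom_subproof a).
Proof. by apply: val_inj; rewrite /= gmapE (lift_act uL). Qed.

Definition lift_hom : slice_hom A (star_obj f B) :=
  @mk_slice_hom _ _ A (star_obj f B) _ lift_hom_act (fun=> erefl).

End LiftHom.

Variables (g : cell1 Y Z) (f : cell1 X Y).

Section StarComp.
Variable C : slice Z.

Definition star_split_fun (p : star_obj (g \o1 f) C) : star_obj f (star_obj g C) :=
  @star_pt _ _ f (star_obj g C) (val p).1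
    (@star_pt _ _ g C (f (val p).1) (val p).2 (valP p)) (eqxx _).

Lemma star_split_act h p : star_split_fun (h *> p) = h *> star_split_fun p.
Proof.
apply: val_inj; rewrite /=; congr (_, _); apply: val_inj => /=.
by rewrite c1mapE.
Qed.

(** With [star_merge] below, the two directions of the isomorphism between
    restriction along a composite and iterated restriction. *)
Definition star_split := mk_slice_hom star_split_act (fun=> erefl).

Lemma star_merge_subproof (p : star_obj f (star_obj g C)) :
  (g \o1 f) (val p).1 == sproj C (val (val p).2).2.
Proof. by rewrite /= (eqP (valP p)) (valP (val p).2). Qed.

Definition star_merge_fun p := star_pt (star_merge_subproof p).

Lemma star_splitK : cancel star_split star_merge_fun.
Proof. by move=> p; apply: val_inj; case: p => [[]]. Qed.

Lemma star_mergeK : cancel star_merge_fun star_split.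
Proof.
move=> [[x [[y c] e']] e]; apply: val_inj; congr (_, _); apply: val_inj.
by rewrite /= (eqP e).
Qed.

Lemma star_merge_act h p : star_merge_fun (h *> p) = h *> star_merge_fun p.
Proof. by rewrite -{1}(star_mergeK p) -gmapE star_splitK. Qed.

Lemma star_merge_proj p :
  sproj (star_obj (g \o1 f) C) (star_merge_fun p) = sproj (star_obj f (star_obj g C)) p.
Proof. by []. Qed.

Definition star_merge := mk_slice_hom star_merge_act star_merge_proj.

End StarComp.

Lemma star_split_map (C D : slice Z) (m : slice_hom C D) t :
  star_split D (star_map (g \o1 f) m t) = star_map f (star_map g m) (star_split C t).
Proof. by apply: val_inj; congr (_, _); apply: val_inj. Qed.

End StarHoms.

Lemma burnside_star_id (X : cell0) : burnside_star (cell1_id X) =1 id.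
Proof.
elim/burnside_ind=> A; rewrite burnside_starE; apply/iso_classP.
apply: (@slice_isoI _ _ (star_obj (cell1_id X) A) A (fun p => (val p).2)
  (fun a => exist _ (sproj A a, a) (eqxx _))) => //.
  by move=> p; rewrite -(eqP (valP p)).
by move=> [[x a] p]; apply/val_inj; rewrite /= -(eqP p).
Qed.

Lemma burnside_star_comp (X Y Z : cell0) (g : cell1 Y Z) (f : cell1 X Y) :
  burnside_star (g \o1 f) =1 burnside_star f \o burnside_star g.
Proof.
elim/burnside_ind=> C /=; rewrite !burnside_starE; apply/iso_classP.
exists (star_split g f C), (star_merge g f C).
by split; [apply: star_splitK | apply: star_mergeK].
Qed.

Section StarCell2.
Variables (X Y : cell0) (f f' : cell1 X Y) (e : X -> cgrp Y).
Hypothesis fe : is_cell2 f f' e.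
Variable B : slice Y.

Lemma star_cell2_subproof (p : star_obj f B) :
  f' (val p).1 == sproj B (e (val p).1 *> (val p).2).
Proof. by rewrite gmapE fe.1 (eqP (valP p)). Qed.

Definition star_cell2_fun (p : star_obj f B) : star_obj f' B :=
  exist _ (_, _) (star_cell2_subproof p).

Lemma star_cell2_act g p : star_cell2_fun (g *> p) = g *> star_cell2_fun p.
Proof.
apply/val_inj; rewrite /=; congr (_, _); rewrite -!gactM; congr (_ *> _).
by rewrite -fe.2 mulgKV.
Qed.

Definition star_cell2 : slice_hom (star_obj f B) (star_obj f' B) :=
  @SliceHom _ _ (star_obj f B) (star_obj f' B) (GMap star_cell2_act) (fun=> erefl).

End StarCell2.

Lemma star_cell2K (X Y : cell0) (f f' : cell1 X Y) e e' (fe : is_cell2 f f' e)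
    (fe' : is_cell2 f' f e') (B : slice Y) :
  (forall x, e' x * e x = 1) -> cancel (star_cell2 fe B) (star_cell2 fe' B).
Proof. by move=> ee' [[x b] p]; apply/val_inj; rewrite /= -gactM ee' gact1. Qed.

Lemma burnside_star_cell2 (X Y : cell0) (f f' : cell1 X Y) e :
  is_cell2 f f' e -> burnside_star f =1 burnside_star f'.
Proof.
move=> fe; elim/burnside_ind=> B; rewrite !burnside_starE; apply/iso_classP.
exists (star_cell2 fe B), (star_cell2 (cell2_inv fe) B).
by split; apply: star_cell2K => x; rewrite ?mulVg ?mulgV.
Qed.

Lemma burnside_starD (X Y : cell0) (f : cell1 X Y) :
  {morph burnside_star f : c d / (c + d)%R}.
Proof.
elim/burnside_ind=> A; elim/burnside_ind=> B.
rewrite iso_class_sum !burnside_starE iso_class_sum; apply/iso_classP.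
pose S := slice_sum A B; pose S' := slice_sum (star_obj f A) (star_obj f B).
pose k (p : star_obj f S) : S' := match p with
  | exist (x, inl a) e => inl (exist _ (x, a) e)
  | exist (x, inr b) e => inr (exist _ (x, b) e) end.
pose k' (s : S') : star_obj f S := match s with
  | inl p => exist _ ((val p).1, inl (val p).2) (valP p)
  | inr p => exist _ ((val p).1, inr (val p).2) (valP p) end.
apply: (@slice_isoI _ _ (star_obj f S) S' k k').
- by move=> g [[x [a|b]] e] /=; congr (_ _); apply/val_inj.
- by case=> [[x [a|b]] e].
- by case=> [[x [a|b]] e]; apply/val_inj.
- by case=> [[[x a] e]|[[x b] e]] /=; congr (_ _); apply/val_inj.
Qed.

(** * Right Kan extensions *)

Section Ran.
Variables (X Y : cell0) (f : cell1 X Y).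

(** [ev] is the counit of a right Kan extension: transposition along [ev] is a
    bijection between maps to [R] and maps from restrictions to [A]. *)
Record is_ran (A : slice X) (R : slice Y) (ev : slice_hom (star_obj f R) A) : Prop := IsRan {
  ran_univ : forall T (k : slice_hom (star_obj f T) A),
    exists m : slice_hom T R, forall t, ev (star_map f m t) = k t;
  ran_inj : forall T (m m' : slice_hom T R),
    (forall t, ev (star_map f m t) = ev (star_map f m' t)) -> m =1 m' }.

Section Bullet.
Variable A : slice X.

Lemma zeta_proj t : sproj A (zeta f A t) = sproj (exp_E f A) t.
Proof. by have /andP[_ /eqP] := xchooseP (zeta_exists t). Qed.

Definition zeta_hom : slice_hom (star_obj f (bullet_obj f A)) A := SliceHom zeta_proj.

Lemma zetaE (t : exp_E f A) a0 : zeta_pred t a0 -> zeta f A t = val a0.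
Proof. by move=> ta0; congr val; apply: zeta_unique ta0; apply: xchooseP. Qed.

(** By equivariance a section is determined by its values at the points [1, x] of
    the fibres, and these values are the ones that [zeta] reads off. *)
Lemma pi_sec_zeta (r r' : bullet_obj f A) h x (e : f x == sproj (bullet_obj f A) r') :
    r = h *> r' ->
  forall v : fiber (sim_map f) (pi_base r), val v = bal_class f (slice_id X) h x ->
  exists2 a0 : theta_obj f A, pi_sec r v = bal_class f (theta_obj f A) h a0
    & zeta f A (star_pt e) = val a0.
Proof.
move=> -> v vE; set t : exp_E f A := star_pt e.
have := xchooseP (zeta_exists t); set a0 := xchoose _ => /andP[/eqP c0 _].
exists a0 => //; rewrite [LHS]ffunE.
have -> : fiber_shift (v : fiber _ (h *> pi_base r')) = exp_point t.
  by apply/val_inj; rewrite /= vE [LHS]bal_actE mulVg.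
by rewrite -c0 [LHS]bal_actE mulg1.
Qed.

Lemma bullet_hom_inj T (m m' : slice_hom T (bullet_obj f A)) :
  (forall t, zeta_hom (star_map f m t) = zeta_hom (star_map f m' t)) -> m =1 m'.
Proof.
move=> mm' t; apply: pi_eq => [|v v' vv']; first exact: etrans (hom_proj m t) (esym (hom_proj m' t)).
have [h [x vE]] : exists h x, val v = bal_class f (slice_id X) h x.
  by elim/bal_ind: (val v) => h x; exists h, x.
have e : f x == sproj T (h^-1 *> t).
  rewrite gmapE; apply/eqP/(canRL (gactK h)).
  apply: etrans (hom_proj m t); apply: etrans (eqP (valP v)).
  by rewrite vE [RHS]sim_funE.
have em (n : slice_hom T (bullet_obj f A)) : f x == sproj (bullet_obj f A) (n (h^-1 *> t)).
  by rewrite hom_proj.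
have nt (n : slice_hom T (bullet_obj f A)) : n t = h *> n (h^-1 *> t).
  by rewrite gmapE gactKV.
have [a0 -> z0] := pi_sec_zeta (em m) (nt m) vE.
have [a1 -> z1] := pi_sec_zeta (em m') (nt m') (etrans (esym vv') vE).
congr bal_class; apply/val_inj; rewrite -z0 -z1.
have := mm' (star_pt e).
by congr (zeta f A _ = zeta f A _); apply/val_inj.
Qed.

Section Transpose.
Variables (T : slice Y) (k : slice_hom (star_obj f T) A).

(** This is why the exponent theta appears in [bullet_obj]: on a restriction
    along [f] a group element acts through its effect on [X] and its image under [f]
    alone, so every map out of a restriction lands in [theta_obj f A]. *)
Lemma transpose_theta (p : star_obj f T) : theta_pred f (k p).
Proof.
apply/theta_predP => g g'; rewrite hom_proj => e1 e2.
by rewrite -!gmapE; congr (k _); apply/val_inj; rewrite /= e1; congr (_, _).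
Qed.

Definition transpose_val (p : star_obj f T) : theta_obj f A := exist _ (k p) (transpose_theta p).

Lemma transpose_pt (t : T) h x :
  h *> f x = sproj T t -> f x == sproj T (h^-1 *> t).
Proof. by rewrite gmapE => <-; rewrite gactK. Qed.

Lemma transpose_sec_subproof (t : T) (v : fiber (sim_map f) (sproj T t)) :
  bal_fst (val v) *> f (bal_snd (val v)) = sproj T t.
Proof. exact: (eqP (valP v)). Qed.

Definition transpose_sec (t : T) : {ffun fiber (sim_map f) (sproj T t) -> S_obj f (theta_obj f A)} :=
  [ffun v => bal_class f (theta_obj f A) (bal_fst (val v))
     (transpose_val (star_pt (transpose_pt (transpose_sec_subproof v))))].

(** The section is defined on the chosen representative of a point of the fibre;
    any other representative gives the same value. *)
Lemma transpose_secE t v h x (e : h *> f x = sproj T t) :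
    val v = bal_class f (slice_id X) h x ->
  transpose_sec t v =
    bal_class f (theta_obj f A) h (transpose_val (star_pt (transpose_pt e))).
Proof.
move=> vE; rewrite ffunE; apply/eqP/bal_classP.
have /eqP/bal_classP[g /= xg hg] := etrans (bal_repr (val v)) vE.
have hp := hom_proj k (star_pt (transpose_pt (transpose_sec_subproof v))).
exists g; last exact: etrans hg (congr1 (fun z => h * c1coc f z g) (esym hp)).
apply/val_inj; rewrite /= -gmapE; congr (k _); apply/val_inj; rewrite /=; congr (_, _) => //.
rewrite -gactM; congr (_ *> _); rewrite hg invMg mulgA mulgV mul1g //.
Qed.

Lemma transpose_secP t v : sproj (S_obj f (theta_obj f A)) (transpose_sec t v) = val v.
Proof.
by rewrite ffunE /= bal_mapE -[RHS]bal_repr /= hom_proj.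
Qed.

Definition transpose_fun (t : T) : bullet_obj f A := pi_mk (@transpose_secP t).

Lemma transpose_act h t : transpose_fun (h *> t) = h *> transpose_fun t.
Proof.
apply: pi_eq => [|v v' vv']; first exact: gmapE.
rewrite [RHS]ffunE.
have [h' [x vE]] : exists h' x, val v = bal_class f (slice_id X) h' x.
  by elim/bal_ind: (val v) => h' x; exists h', x.
have e : h' *> f x = sproj T (h *> t).
  by apply: etrans (eqP (valP v)); rewrite vE [RHS]sim_funE.
rewrite (transpose_secE e vE).
have e' : (h^-1 * h') *> f x = sproj T t by rewrite gactM e gmapE gactK.
rewrite (@transpose_secE _ (fiber_shift v') _ _ e'); last first.
  by rewrite /= -vv' vE [LHS]bal_actE.
rewrite [RHS]bal_actE mulKVg; congr bal_class; apply/val_inj; congr (k _).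
by apply/val_inj; rewrite /= -gactM invMg invgK.
Qed.

Definition transpose : slice_hom T (bullet_obj f A) :=
  @SliceHom _ _ T (bullet_obj f A) (GMap transpose_act) (fun=> erefl).

Lemma zeta_transpose t : zeta_hom (star_map f transpose t) = k t.
Proof.
have := @zetaE (star_map f transpose t) (transpose_val t); apply.
rewrite /zeta_pred [sproj _ _]hom_proj eqxx andbT.
have e : 1 *> f (val t).1 = sproj T (val t).2 by rewrite gact1; apply/eqP/(valP t).
rewrite (@transpose_secE _ _ _ _ e) //; apply/eqP; congr bal_class; apply/val_inj.
congr (k _); apply/val_inj; rewrite /= invg1 gact1; by case: t {e} => [[]].
Qed.

End Transpose.

(** The section attached to [t] by a map [k] is [h, x] |-> [h, k (x, h^-1 t)]. *)
Lemma bullet_is_ran : is_ran zeta_hom.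
Proof.
by split=> [T k|T m m']; [exists (transpose k); apply: zeta_transpose | apply: bullet_hom_inj].
Qed.

End Bullet.
End Ran.

Lemma ran_iso (X Y : cell0) (f : cell1 X Y) (A : slice X) (R R' : slice Y)
    (ev : slice_hom (star_obj f R) A) (ev' : slice_hom (star_obj f R') A) :
  is_ran ev -> is_ran ev' -> slice_iso R R'.
Proof.
move=> evP ev'P; have [m mE] := ran_univ ev'P ev; have [m' m'E] := ran_univ evP ev'.
exists m, m'; split.
  apply: (ran_inj evP (m := slice_hom_comp m' m) (m' := slice_hom_id R)) => t.
  by rewrite star_map_comp m'E mE; congr (ev _); apply: val_inj; case: t => [[]].
apply: (ran_inj ev'P (m := slice_hom_comp m m') (m' := slice_hom_id R')) => t.
by rewrite star_map_comp mE m'E; congr (ev' _); apply: val_inj; case: t => [[]].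
Qed.

Lemma burnside_bullet_ran (X Y : cell0) (f : cell1 X Y) (A : slice X) (R : slice Y)
    (ev : slice_hom (star_obj f R) A) :
  is_ran ev -> burnside_bullet f (iso_class A) = iso_class R.
Proof.
move=> evP; rewrite burnside_bulletE; apply/iso_classP.
exact: ran_iso (bullet_is_ran f A) evP.
Qed.

Lemma burnside_bullet_id (X : cell0) : burnside_bullet (cell1_id X) =1 id.
Proof.
elim/burnside_ind=> A.
have evP (t : star_obj (cell1_id X) A) : sproj A (val t).2 = (val t).1.
  by rewrite -(eqP (valP t)).
apply: (burnside_bullet_ran (ev := @mk_slice_hom _ _ (star_obj (cell1_id X) A) A
  (fun t => (val t).2) (fun _ _ => erefl) evP)); split=> [T k|T m m' mm' t].
  have idL : is_lift (cell1_id X) (id : T -> T) by [].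
  exists (slice_hom_comp k (lift_hom idL)) => t /=; congr (k _); apply: val_inj => /=.
  by rewrite -(eqP (valP t)); case: t => [[]].
exact: mm' (star_pt (f := cell1_id X) (x := sproj T t) (b := t) (eqxx _)).
Qed.

(** Right adjoints compose. *)
Lemma ran_comp (X Y Z : cell0) (f : cell1 X Y) (g : cell1 Y Z) (A : slice X)
    (R : slice Y) (Q : slice Z) (ev : slice_hom (star_obj f R) A)
    (ev' : slice_hom (star_obj g Q) R) :
    is_ran ev -> is_ran ev' ->
  is_ran (slice_hom_comp ev (slice_hom_comp (star_map f ev') (star_split g f Q))).
Proof.
move=> evP ev'P; split=> [T k|T m m' mm'].
  have [n nE] := ran_univ evP (slice_hom_comp k (star_merge g f T)).
  have [m mE] := ran_univ ev'P n; exists m => t.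
  rewrite -[LHS]/(ev (star_map f ev' (star_split g f Q (star_map (g \o1 f) m t)))).
  rewrite star_split_map -star_map_comp (star_map_ext (k' := n)) // nE.
  by congr (k _); apply: star_splitK.
apply: (ran_inj ev'P) => t.
apply: (ran_inj evP (m := slice_hom_comp ev' (star_map g m))
  (m' := slice_hom_comp ev' (star_map g m'))) => s.
rewrite !star_map_comp -(star_mergeK s) -!star_split_map; exact: mm'.
Qed.

Lemma burnside_bullet_comp (X Y Z : cell0) (g : cell1 Y Z) (f : cell1 X Y) :
  burnside_bullet (g \o1 f) =1 burnside_bullet g \o burnside_bullet f.
Proof.
elim/burnside_ind=> A /=; rewrite (burnside_bullet_ran (bullet_is_ran f A)).
rewrite (burnside_bullet_ran (bullet_is_ran g _)).
exact: burnside_bullet_ran (ran_comp (bullet_is_ran f A) (bullet_is_ran g _)).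
Qed.

Lemma star_cell2_map (X Y : cell0) (f f' : cell1 X Y) e (fe : is_cell2 f f' e)
    (B C : slice Y) (m : slice_hom B C) t :
  star_cell2 fe C (star_map f m t) = star_map f' m (star_cell2 fe B t).
Proof. by apply: val_inj; rewrite /= gmapE. Qed.

Lemma ran_cell2 (X Y : cell0) (f f' : cell1 X Y) e (fe : is_cell2 f' f e)
    (A : slice X) (R : slice Y) (ev : slice_hom (star_obj f R) A) :
  is_ran ev -> is_ran (slice_hom_comp ev (star_cell2 fe R)).
Proof.
move=> evP; have fK T : cancel (star_cell2 fe T) (star_cell2 (cell2_inv fe) T).
  by apply: star_cell2K => x; rewrite mulVg.
have fVK T : cancel (star_cell2 (cell2_inv fe) T) (star_cell2 fe T).
  by apply: star_cell2K => x; rewrite mulgV.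
split=> [T k|T m m' mm'].
  have [m mE] := ran_univ evP (slice_hom_comp k (star_cell2 (cell2_inv fe) T)).
  exists m => t; rewrite -[LHS]/(ev (star_cell2 fe R (star_map f' m t))).
  by rewrite star_cell2_map mE /= [star_cell2_fun _ _]fK.
by apply: (ran_inj evP) => t; rewrite -(fVK _ t) -(star_cell2_map fe m) -(star_cell2_map fe m'); apply: mm'.
Qed.

Lemma burnside_bullet_cell2 (X Y : cell0) (f f' : cell1 X Y) e :
  is_cell2 f f' e -> burnside_bullet f =1 burnside_bullet f'.
Proof.
move=> fe; elim/burnside_ind=> A; rewrite (burnside_bullet_ran (bullet_is_ran f A)).
by rewrite (burnside_bullet_ran (ran_cell2 (cell2_inv fe) (bullet_is_ran f A))).
Qed.

Section RanBaseChange.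
Variables (A1 A2 B P : cell0) (f1 : cell1 A1 B) (f2 : cell1 A2 B).
Variables (p1 : cell1 P A1) (p2 : cell1 P A2) (kap : P -> cgrp B).

Lemma comma_sym : is_comma f1 f2 p1 p2 kap -> is_comma f2 f1 p2 p1 (fun p => (kap p)^-1).
Proof.
case=> kC surj full; split=> [|x2 x1 b e|p p' g2 g1 e2 e1 e].
- exact: cell2_inv.
- have [|p [g1 [g2 [e1 e2 e12]]]] := surj x1 x2 b^-1; first by rewrite e gactK.
  exists p, g2, g1; split=> //; apply: (mulgI b^-1); rewrite mulKg mulgA e12 mulgK //.
have [//|//||k [ek ek1 ek2]] := full p p' g1 g2; last by exists k.
by apply: (mulgI (kap p')^-1); rewrite mulKg mulgA e mulgKV.
Qed.

Hypothesis cP : is_comma f1 f2 p1 p2 kap.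
Variables (A : slice A2) (R : slice B) (ev : slice_hom (star_obj f2 R) A).
Hypothesis evP : is_ran ev.

Definition base_change_ev : slice_hom (star_obj p1 (star_obj f1 R)) (star_obj p2 A) :=
  slice_hom_comp (star_map p2 ev) (slice_hom_comp (star_split f2 p2 R)
    (slice_hom_comp (star_cell2 (comma_cell cP) R) (star_merge f1 p1 R))).

(** Passing to left adjoints, a map from [T] to [star_obj f1 R] is a map from
    the restriction along [f2] of the left extension of [T] along [f1]; base
    change for left extensions in the transposed square identifies that object
    with the left extension along [p2] of the restriction of [T] along [p1]. *)
Lemma ran_base_change : is_ran base_change_ev.
Proof.
split=> [T k|T m m' mm' t]; have uL := plus_is_lan f1 T.
  (* k is transposed along v, then along ev, and finally along u. *)
  have [v vL vE] := lan_base_change (comma_sym cP) uL.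
  have [n nE] := lan_univ vL (lift_star k).
  have [m0 m0E] := ran_univ evP n.
  have m0L : is_lift f1 (fun t => m0 (plus_unit f1 t)).
    by split=> [t|g t]; rewrite ?hom_proj ?(lift_proj uL) // (lift_act uL) gmapE.
  exists (lift_hom m0L) => t; apply: val_inj.
  have kt : (val t).1 = (val (k t)).1 by rewrite -[LHS]/(sproj _ t) -(hom_proj k).
  rewrite [RHS]surjective_pairing -kt; congr (_, _).
  rewrite -nE -m0E; congr (ev _); apply: val_inj; rewrite /= vE invgK gmapE.
  by congr (_, _); apply: esym (lift_proj vL t).
have [n nE] := lan_univ uL (lift_star m); have [n' n'E] := lan_univ uL (lift_star m').
suff nn' : n =1 n'.
  apply: val_inj; rewrite [LHS]surjective_pairing [RHS]surjective_pairing.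
  congr (_, _); last by rewrite -nE -n'E nn'.
  exact: etrans (hom_proj m t) (esym (hom_proj m' t)).
apply: (ran_inj evP); have [v vL vE] := lan_base_change (comma_sym cP) uL.
apply: (lan_hom_eq (k := slice_hom_comp ev (star_map f2 n))
  (k' := slice_hom_comp ev (star_map f2 n')) vL) => s /=.
have /(congr1 (fun r => (val r).2)) := mm' s; rewrite /=.
by congr (ev _ = ev _); apply: val_inj; rewrite /= vE invgK gmapE ?nE ?n'E;
  congr (_, _); apply: esym (lift_proj vL s).
Qed.

End RanBaseChange.

Lemma burnside_star_bullet_comma (A1 A2 B P : cell0) (f1 : cell1 A1 B) (f2 : cell1 A2 B)
    (p1 : cell1 P A1) (p2 : cell1 P A2) kap :
    is_comma f1 f2 p1 p2 kap ->
  burnside_star f1 \o burnside_bullet f2 =1 burnside_bullet p1 \o burnside_star p2.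
Proof.
move=> cP; elim/burnside_ind=> A /=; have evP := bullet_is_ran f2 A.
by rewrite (burnside_bullet_ran evP) !burnside_starE (burnside_bullet_ran (ran_base_change cP evP)).
Qed.

(** * The exponential formula *)

Section Exponential.
Variables (G H : finGroupType) (X : gset G) (Y : gset H).
Variables (f : cell1 (Cell0 X) (Cell0 Y)) (A : slice X) (B : slice A).

Local Notation zetaB := (star_obj (cell1_of_gmap (zeta f A)) B).
Local Notation fdia := (exp_cell f A).

Variables (Q : slice (exp_P f A)) (evQ : slice_hom (star_obj fdia Q) zetaB).
Hypothesis evQP : is_ran evQ.

Local Notation R := (slice_postcomp (sproj (exp_P f A)) Q).
Local Notation C := (slice_postcomp (sproj A) B).

(** An element of the restriction of [Q] along [f] has a well-defined position in
    the exponential object, given by its projection to [exp_P f A]. *)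
Definition dia_pt (r : star_obj f R) : star_obj fdia Q :=
  @star_pt _ _ fdia Q (@star_pt _ _ f (exp_P f A) (val r).1 (sproj Q (val r).2) (valP r))
    (val r).2 (eqxx _).

Lemma dia_pt_act g r : dia_pt (g *> r) = g *> dia_pt r.
Proof. by apply: val_inj; congr (_, _); apply: val_inj; rewrite /= gmapE. Qed.

Lemma evQ1 p : (val (evQ p)).1 = (val p).1.
Proof. exact: (hom_proj evQ p). Qed.

Lemma evQ2 p : sproj B (val (evQ p)).2 = zeta f A (val p).1.
Proof. by rewrite -evQ1 -(eqP (valP (evQ p))). Qed.

Definition exp_ev_fun (r : star_obj f R) : C := (val (evQ (dia_pt r))).2.

Lemma exp_ev_act g r : exp_ev_fun (g *> r) = g *> exp_ev_fun r.
Proof. by rewrite /exp_ev_fun dia_pt_act gmapE. Qed.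

Lemma exp_ev_proj r : sproj C (exp_ev_fun r) = sproj (star_obj f R) r.
Proof.
have e1 := congr1 (sproj A) (evQ2 (dia_pt r)).
have e2 := zeta_proj (f := f) (val (dia_pt r)).1.
exact: etrans e1 e2.
Qed.

Definition exp_ev : slice_hom (star_obj f R) C := mk_slice_hom exp_ev_act exp_ev_proj.

Lemma exp_evE r p : (val p).1 = (val (dia_pt r)).1 -> (val p).2 = (val r).2 ->
  exp_ev r = (val (evQ p)).2.
Proof.
move=> e1 e2; rewrite /= /exp_ev_fun; congr (val (evQ _)).2; apply: val_inj.
by rewrite [RHS]surjective_pairing e1 e2.
Qed.

(** A map from [star_obj f T] to [C] gives by projection a map to [A], hence a map
    from [T] to [exp_P f A]; seen over [exp_P f A], the original map is a map to the
    pullback of [B] along [zeta], hence a map from [T] to [Q]. *)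
Lemma exp_is_ran : is_ran exp_ev.
Proof.
split=> [T k|T m m' mm'].
  have sP t : sproj A (sproj B (k t)) = sproj (star_obj f T) t := hom_proj k t.
  have sA g t : sproj B (k (g *> t)) = g *> sproj B (k t) by rewrite !gmapE.
  have [m0 m0E] := ran_univ (bullet_is_ran f A) (mk_slice_hom sA sP).
  pose TP : slice (exp_P f A) := Slice (hom_gmap m0).
  have qP (p : star_obj fdia TP) : f (val (val p).1).1 == sproj T (val p).2.
    rewrite (eqP (valP (val p).1)) -(hom_proj m0); apply/eqP; congr (sproj _ _).
    exact/eqP/(valP p).
  pose q (p : star_obj fdia TP) : star_obj f T := @star_pt _ _ f T _ _ (qP p).
  have sE p : star_map f m0 (q p) = (val p).1.
    apply: val_inj; rewrite [RHS]surjective_pairing; congr (_, _).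
    exact/esym/eqP/(valP p).
  have k'P (p : star_obj fdia TP) : zeta f A (val p).1 == sproj B (k (q p)) by rewrite -sE; apply/eqP/(m0E (q p)).
  pose k' (p : star_obj fdia TP) : zetaB := @star_pt _ _ (cell1_of_gmap (zeta f A)) B _ _ (k'P p).
  have k'A g (p : star_obj fdia TP) : k' (g *> p) = g *> k' p.
    apply: val_inj; rewrite /=; congr (_, _); rewrite -gmapE; congr (k _).
    exact: val_inj.
  have [mP mPE] := ran_univ evQP
    (@mk_slice_hom _ _ (star_obj fdia TP) zetaB k' k'A (fun=> erefl)).
  have mPp t : sproj R (mP t) = sproj T t.
    have e : sproj Q (mP t) = m0 t := hom_proj mP t.
    exact: etrans (congr1 (sproj (exp_P f A)) e) (hom_proj m0 t).
  exists (@mk_slice_hom _ _ T R mP (gmapE mP) mPp) => t.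
  have tP : fdia (star_map f m0 t) == sproj TP (val t).2 by [].
  rewrite (exp_evE (p := star_map fdia mP (star_pt tP))) => [||//].
    by rewrite mPE /=; congr (k _); apply: val_inj; rewrite [RHS]surjective_pairing.
  by apply: val_inj; congr (_, _); apply/esym/(hom_proj mP).
have nP (m1 : slice_hom T R) t : sproj (exp_P f A) (sproj Q (m1 t)) = sproj T t.
  exact: (hom_proj m1 t).
have nA (m1 : slice_hom T R) g t : sproj Q (m1 (g *> t)) = g *> sproj Q (m1 t).
  by rewrite !gmapE.
pose n m1 : slice_hom T (exp_P f A) := mk_slice_hom (nA m1) (nP m1).
have nE m1 t : zeta f A (star_map f (n m1) t) = sproj B (exp_ev (star_map f m1 t)).
  by rewrite /= evQ2; congr (zeta f A _); apply: val_inj.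
have nn' : n m =1 n m'.
  apply: bullet_hom_inj => t.
  exact: etrans (nE m t) (etrans (congr1 (sproj B) (mm' t)) (esym (nE m' t))).
(* The two maps induce the same map to exp_P, so both are maps over exp_P. *)
pose TP : slice (exp_P f A) := Slice (hom_gmap (n m)).
pose mP := @mk_slice_hom _ _ TP Q m (gmapE m) (fun=> erefl).
pose m'P := @mk_slice_hom _ _ TP Q m' (gmapE m') (fun t => esym (nn' t)).
apply: (ran_inj evQP (m := mP) (m' := m'P)) => p.
have pP : f (val (val p).1).1 == sproj T (val p).2.
  by rewrite (eqP (valP (val p).1)) -(hom_proj (n m)) [(val (val p).1).2](eqP (valP p)).
apply: val_inj; rewrite [LHS]surjective_pairing [RHS]surjective_pairing !evQ1.
congr (_, _); have := mm' (star_pt pP).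
rewrite (exp_evE (p := star_map fdia mP p)) => [|//|//]; last first.
  by apply: val_inj; rewrite [LHS]surjective_pairing; congr (_, _); apply/eqP/(valP p).
rewrite (exp_evE (p := star_map fdia m'P p)) => [//|//|//].
apply: val_inj; rewrite [LHS]surjective_pairing; congr (_, _).
by rewrite [LHS](eqP (valP p)); apply: nn'.
Qed.

End Exponential.

Lemma burnside_exponential (G H : finGroupType) (X : gset G) (Y : gset H)
    (f : cell1 (Cell0 X) (Cell0 Y)) (A : slice X) :
  burnside_bullet f \o burnside_plus (cell1_of_gmap (sproj A)) =1
  burnside_plus (cell1_of_gmap (sproj (exp_P f A)))
    \o burnside_bullet (exp_cell f A)
    \o burnside_star (cell1_of_gmap (zeta f A)).
Proof.
elim/burnside_ind=> B; rewrite /= burnside_plus_gmap burnside_starE.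
have evQP := bullet_is_ran (exp_cell f A) (star_obj (cell1_of_gmap (zeta f A)) B).
by rewrite (burnside_bullet_ran (exp_is_ran evQP)) (burnside_bullet_ran evQP) burnside_plus_gmap.
Qed.

(** * Polynomiality of right Kan extension *)

Section SubSlice.
Variables (G : finGroupType) (X : gset G) (A : slice X).

Section Def.
Variables (P : pred A) (PG : forall g a, P (g *> a) = P a).

Lemma sub_act_subproof g (a : {a : A | P a}) : P (g *> val a).
Proof. by rewrite PG (valP a). Qed.

Definition sub_act g (a : {a : A | P a}) : {a : A | P a} :=
  exist _ (g *> val a) (sub_act_subproof g a).

Lemma sub_act1 a : sub_act 1 a = a.
Proof. by apply: val_inj; apply: gact1. Qed.

Lemma sub_actM g g' a : sub_act (g * g') a = sub_act g (sub_act g' a).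
Proof. by apply: val_inj; apply: gactM. Qed.

Definition sub_gset : gset G := GSet sub_act1 sub_actM.

Definition sub_slice : slice X :=
  @Slice G X sub_gset
    (@GMap G sub_gset X (fun a => sproj A (val a)) (fun g a => gmapE (sproj A) g (val a))).

End Def.

Lemma iso_class_sub_ext (P P' : pred A) PG P'G :
  P =1 P' -> iso_class (@sub_slice P PG) = iso_class (@sub_slice P' P'G).
Proof.
move=> PP'; apply/iso_classP.
have to (a : @sub_slice P PG) : P' (val a) by rewrite -PP' (valP a).
have from (a : @sub_slice P' P'G) : P (val a) by rewrite PP' (valP a).
apply: (@slice_isoI _ _ (sub_slice PG) (sub_slice P'G)
  (fun a => exist _ (val a) (to a)) (fun a => exist _ (val a) (from a))) => [g a|//|a|a];
exact: val_inj.
Qed.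

Lemma iso_class_sub0 (P : pred A) PG : P =1 xpred0 -> iso_class (@sub_slice P PG) = 0%R.
Proof.
move=> P0; rewrite -[RHS]/(iso_class (slice_empty X)); apply/iso_classP.
have no (a : sub_slice PG) : False by have := valP a; rewrite P0.
by apply: (@slice_isoI _ _ (sub_slice PG) (slice_empty X)
  (fun a => match no a with end) (fun x : void => match x with end)) => [g a|a|a|[]];
  case: (no a).
Qed.

Lemma iso_class_subU (P P' Q : pred A) PG P'G QG :
    (forall a, Q a = P a || P' a) -> (forall a, P a -> ~~ P' a) ->
  iso_class (@sub_slice Q QG) =
    (iso_class (@sub_slice P PG) + iso_class (@sub_slice P' P'G))%R.
Proof.
move=> QE PP'; rewrite iso_class_sum; apply/esym/iso_classP.
have lP (a : sub_slice PG) : Q (val a) by rewrite QE (valP a).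
have rP (a : sub_slice P'G) : Q (val a) by rewrite QE (valP a) orbT.
pose k (s : slice_sum (sub_slice PG) (sub_slice P'G)) : sub_slice QG :=
  match s with inl a => exist _ (val a) (lP a) | inr a => exist _ (val a) (rP a) end.
have kA g s : k (g *> s) = g *> k s by apply: val_inj; case: s.
have kP s : sproj (sub_slice QG) (k s)
    = sproj (slice_sum (sub_slice PG) (sub_slice P'G)) s by case: s.
apply: (slice_iso_bij (k := mk_slice_hom kA kP)) => [s s'|a] /=.
  case: s s' => a [a'|a'] [/= e]; last by congr inr; apply: val_inj.
  - by congr inl; apply: val_inj.
  - by case/negP: (PP' _ (valP a)); rewrite [val a]e; apply: (valP a').
  - by case/negP: (PP' _ (valP a')); rewrite -[val a']e; apply: (valP a).
have /orP[Pa|P'a] : P (val a) || P' (val a) by rewrite -QE; apply: (valP a).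
  by exists (inl (exist _ (val a) Pa)); apply: val_inj.
by exists (inr (exist _ (val a) P'a)); apply: val_inj.
Qed.

Section Labels.
Variables (J : finType) (l : A -> J) (lG : forall g a, l (g *> a) = l a).

Lemma label_subproof (S : {set J}) g a : (l (g *> a) \in S) = (l a \in S).
Proof. by rewrite lG. Qed.

Definition label_sub (S : {set J}) : slice X :=
  @sub_slice (fun a => l a \in S) (label_subproof S).

Lemma iso_class_label_sub (S : {set J}) :
  iso_class (label_sub S) = (\sum_(j in S) iso_class (label_sub [set j]))%R.
Proof.
have [n] := ubnP #|S|; elim: n S => // n IHn S Sn.
have [->|[j jS]] := set_0Vmem S.
  by rewrite big_set0; apply: iso_class_sub0 => a; rewrite inE.
rewrite -(setD1K jS) big_setU1 ?setD11 //= -IHn; last first.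
  by move: Sn; rewrite (cardsD1 j S) jS.
apply: iso_class_subU => a; first by rewrite in_setU1 in_set1.
by rewrite in_set1 => /eqP->; rewrite setD11.
Qed.

End Labels.
End SubSlice.

Section BigSum.
Variables (G : finGroupType) (X : gset G) (J : finType) (V : J -> slice X).

Definition bigsum_act g (u : {j : J & V j}) : {j : J & V j} :=
  Tagged (fun j => V j : Type) (g *> tagged u).

Lemma bigsum_act1 u : bigsum_act 1 u = u.
Proof. by case: u => j a; rewrite /bigsum_act /= gact1. Qed.

Lemma bigsum_actM g g' u : bigsum_act (g * g') u = bigsum_act g (bigsum_act g' u).
Proof. by rewrite /bigsum_act /= gactM. Qed.

Definition bigsum_gset : gset G := @GSet G {j : J & V j} bigsum_act bigsum_act1 bigsum_actM.

Definition slice_bigsum : slice X :=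
  @Slice G X bigsum_gset (@GMap G bigsum_gset X (fun u => sproj (V (tag u)) (tagged u))
    (fun g u => gmapE (sproj (V (tag u))) g (tagged u))).

Definition bigsum_label (u : slice_bigsum) : J := tag u.

Lemma bigsum_label_act g u : bigsum_label (g *> u) = bigsum_label u.
Proof. by []. Qed.

Lemma iso_class_bigsum_part j :
  iso_class (label_sub bigsum_label_act [set j]) = iso_class (V j).
Proof.
apply/esym/iso_classP.
have kP (a : V j) : bigsum_label (Tagged (fun j => V j : Type) a) \in [set j].
  by rewrite in_set1.
pose k (a : V j) : label_sub bigsum_label_act [set j] :=
  exist _ (Tagged (fun j => V j : Type) a) (kP a).
have kA g a : k (g *> a) = g *> k a by apply: val_inj.
apply: (slice_iso_bij (k := mk_slice_hom kA (fun=> erefl))) => [a a' [e]|[[j' a] j'P]].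
  by have := congr1 (tagged_as (Tagged (fun j => V j : Type) a)) e; rewrite !tagged_asE.
have /set1P/= e : bigsum_label (Tagged (fun j => V j : Type) a) \in [set j] by [].
by subst j'; exists a; apply: val_inj.
Qed.

End BigSum.

Section BulletSupport.
Variables (X Y : cell0) (f : cell1 X Y) (A : slice X) (R : slice Y).
Variables (ev : slice_hom (star_obj f R) A) (evP : is_ran ev).
Variables (T : finType) (l : A -> option T) (lG : forall g a, l (g *> a) = l a).

Definition supp_val (r : R) (xh : X * cgrp Y) : option T :=
  obind (fun p : star_obj f R => l (ev p)) (insub (xh.1, xh.2 *> r)).

(** The summands, labelled by [l], that the section [r] meets; all its values are
    obtained by evaluating translates of [r] at points of [X]. *)
Definition supp (r : R) : {set T} := [set i | Some i \in codom (supp_val r)].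

Lemma suppP r i :
  reflect (exists x h (e : f x == sproj R (h *> r)), l (ev (star_pt e)) = Some i)
          (i \in supp r).
Proof.
rewrite inE; apply: (iffP codomP) => [[[x h]]|[x [h [e le]]]].
  rewrite /supp_val; case: insubP => //= p e pE le.
  by exists x, h, e; rewrite le; congr (l (ev _)); apply: val_inj; apply: esym pE.
exists (x, h); rewrite /supp_val; case: insubP => [p _ pE /=|/negP//].
by rewrite -le; congr (l (ev _)); apply: val_inj; apply: esym pE.
Qed.

Lemma card_supp r : (#|supp r| <= #|{: X * cgrp Y}|)%N.
Proof.
rewrite -(card_imset _ (@Some_inj _ : injective (@Some T))); apply: leq_trans (leq_image_card (supp_val r) _).
by apply/subset_leq_card/subsetP => _ /imsetP[i ir ->]; move: ir; rewrite inE.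
Qed.

Lemma supp_act h r : supp (h *> r) = supp r.
Proof.
suff imp h' r' : supp (h' *> r') \subset supp r'.
  by apply/eqP; rewrite eqEsubset imp -{1}(gactK h r) imp.
apply/subsetP=> i /suppP[x [k [e le]]]; apply/suppP; exists x, (k * h').
have e' : f x == sproj R ((k * h') *> r') by rewrite gactM.
by exists e'; rewrite -le; congr (l (ev _)); apply: val_inj; rewrite /= gactM.
Qed.

Lemma part_subproof (S : {set T}) g a :
  (if l (g *> a) is Some i then i \in S else true) =
  (if l a is Some i then i \in S else true).
Proof. by rewrite lG. Qed.

Definition part_sub (S : {set T}) : slice X :=
  @sub_slice _ _ A (fun a => if l a is Some i then i \in S else true) (part_subproof S).

Variable S : {set T}.
Local Notation RS := (label_sub supp_act (powerset S)).

Lemma supp_sub_subproof (p : star_obj f RS) : f (val p).1 == sproj R (val (val p).2).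
Proof. exact: (valP p). Qed.

Lemma part_ev_subproof (p : star_obj f RS) :
  if l (ev (star_pt (supp_sub_subproof p))) is Some i then i \in S else true.
Proof.
case le: (l _) => [i|//].
have := valP (val p).2; rewrite powersetE => /subsetP; apply; apply/suppP.
have e : f (val p).1 == sproj R (1 *> val (val p).2) by rewrite gact1 (valP p).
exists (val p).1, 1, e; rewrite -le; congr (l (ev _)); apply: val_inj.
by rewrite /= gact1.
Qed.

Definition part_ev_fun (p : star_obj f RS) : part_sub S :=
  exist _ (ev (star_pt (supp_sub_subproof p))) (part_ev_subproof p).

Lemma part_ev_act g p : part_ev_fun (g *> p) = g *> part_ev_fun p.
Proof.
by apply: val_inj; rewrite /= -gmapE; congr (ev _); apply: val_inj.
Qed.

Lemma part_ev_proj p : sproj (part_sub S) (part_ev_fun p) = sproj (star_obj f RS) p.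
Proof. exact: hom_proj ev _. Qed.

Definition part_ev := mk_slice_hom part_ev_act part_ev_proj.

(** A section of the part of [A] labelled by [S] is a section of [A] whose support
    is contained in [S]. *)
Lemma part_is_ran : is_ran part_ev.
Proof.
split=> [U k|U m m' mm'].
  have kA g u : val (k (g *> u)) = g *> val (k u) by rewrite gmapE.
  have kP u : sproj A (val (k u)) = sproj (star_obj f U) u := hom_proj k u.
  have [m mE] := ran_univ evP (mk_slice_hom kA kP).
  have mS u : supp (m u) \in powerset S.
    rewrite powersetE; apply/subsetP=> i /suppP[x [h [e le]]].
    have e' : f x == sproj U (h *> u) by rewrite (eqP e) -gmapE hom_proj.
    have := valP (k (star_pt e')); have := mE (star_pt e'); rewrite /= => <-.
    suff -> : star_map_fun m (star_pt e') = star_pt e by rewrite le.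
    by apply: val_inj; rewrite /= gmapE.
  pose n u : RS := exist _ (m u) (mS u).
  have nA g u : n (g *> u) = g *> n u by apply: val_inj; apply: gmapE.
  exists (@mk_slice_hom _ _ U RS n nA (hom_proj m)) => u; apply: val_inj.
  by rewrite -[RHS](mE u); congr (ev _); apply: val_inj.
have vA (n : slice_hom U RS) g u : val (n (g *> u)) = g *> val (n u) by rewrite gmapE.
have vP (n : slice_hom U RS) u : sproj R (val (n u)) = sproj U u := hom_proj n u.
move=> u; apply: val_inj.
apply: (ran_inj evP (m := mk_slice_hom (vA m) (vP m)) (m' := mk_slice_hom (vA m') (vP m'))) => t.
by have /(congr1 val) := mm' t; congr (ev _ = ev _); apply: val_inj.
Qed.

Lemma burnside_bullet_part :
  burnside_bullet f (iso_class (part_sub S)) =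
  (\sum_(K in powerset S) iso_class (label_sub supp_act [set K]))%R.
Proof. by rewrite (burnside_bullet_ran part_is_ran) iso_class_label_sub. Qed.

End BulletSupport.

(** Sections of a labelled sum are sorted by their support [K], which gives
    the sum over subsets that the criterion by cubes asks for.  No support has
    more than |X| |H| elements. *)
Lemma burnside_bullet_pol (X Y : cell0) (f : cell1 X Y) :
  pol #|{: X * cgrp Y}|.+1 (fun c => kappa (burnside_bullet f c)).
Proof.
apply: pol_of_cube => T a x.
pose v (o : option T) := class_repr (if o is Some i then a i else x).
pose A := slice_bigsum v; pose l := @bigsum_label _ _ _ v.
pose lG : forall g u, l (g *> u) = l u := @bigsum_label_act _ _ _ v.
have partE o : iso_class (label_sub lG [set o]) = (if o is Some i then a i else x).
  by rewrite -[RHS]class_reprK; apply: iso_class_bigsum_part.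
have AE (S : {set T}) : iso_class (part_sub lG S) = (x + \sum_(i in S) a i)%R.
  have -> : iso_class (part_sub lG S) = iso_class (label_sub lG (None |: Some @: S)).
    apply: iso_class_sub_ext => u; rewrite !inE; case: (l u) => [i|//].
    by rewrite mem_imset //; apply: Some_inj.
  rewrite iso_class_label_sub big_setU1; last by apply/imsetP=> -[].
  rewrite partE; congr (_ + _)%R.
  rewrite big_imset /=; last by move=> ? ? _ _; apply: Some_inj.
  by apply: eq_bigr => i _; rewrite partE.
have evP := bullet_is_ran f A.
exists (fun K => kappa (iso_class (label_sub (supp_act (zeta_hom f A) l) [set K]))).
split=> [S|K Kbig].
  rewrite /cube -AE (burnside_bullet_part evP).
  rewrite (big_morph (@kappa _) (@kappaD _) (kappa0 _)).
  by apply: eq_bigl => K; rewrite powersetE.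
rewrite iso_class_sub0 => [|r]; first exact: kappa0.
rewrite in_set1; apply: contraTF Kbig => /eqP <-; rewrite -leqNgt; exact: card_supp.
Qed.

(** * Bipullbacks and bicoproducts *)

Definition gset_point : gset 'I_1 :=
  @GSet 'I_1 unit (fun _ x => x) (fun=> erefl) (fun _ _ _ => erefl).

Definition cell1_point (Z : cell0) (z : Z) : cell1 (Cell0 gset_point) Z :=
  @Cell1 (Cell0 gset_point) Z (fun=> z) (fun _ _ => 1)
    (fun _ _ => esym (gact1 z)) (fun _ _ _ => esym (mulg1 1)).

Lemma is_cell2_point (Y Z : cell0) (f : cell1 Y Z) (y : Y) (z : Z) (h : cgrp Z) :
  h *> f y = z -> is_cell2 (f \o1 cell1_point y) (cell1_point z) (fun=> h).
Proof. by move=> <-; split=> [//|x g]; rewrite /= /comp_coc /= c1coc1 mulg1 mulgV. Qed.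

(** A 1-cell from the one-point groupoid is an object, and a 2-cell between two
    such 1-cells is a morphism, so the two halves of the universal property at
    this test object are essential surjectivity and full faithfulness. *)
Lemma bipullback_comma (A1 A2 B P : cell0) (f1 : cell1 A1 B) (f2 : cell1 A2 B)
    (p1 : cell1 P A1) (p2 : cell1 P A2) kap :
  is_bipullback f1 f2 p1 p2 kap -> is_comma f1 f2 p1 p2 kap.
Proof.
have cellP x1 x2 b : f2 x2 = b *> f1 x1 ->
    is_cell2 (f1 \o1 cell1_point x1) (f2 \o1 cell1_point x2) (fun=> b).
  by move=> e; split=> [//|x g]; rewrite /= /comp_coc /= !c1coc1 mulg1 mulgV.
case=> kC ex un; split=> // [x1 x2 b e|p p' g1 g2 e1 e2 e].
  have [g [y1 [y2 [[c1 _] [c2 _] c12]]]] := ex _ _ _ _ (cellP _ _ _ e).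
  by exists (g tt), (y1 tt), (y2 tt); split; [exact/esym/c1 | exact/esym/c2 | exact: c12].
have kp' : is_cell2 (f1 \o1 cell1_point (p1 p')) (f2 \o1 cell1_point (p2 p')) (fun=> kap p').
  exact/cellP/kC.1.
have [||z [[zM _] z1 z2] _] := un _ _ _ _ (cell1_point p) (fun=> g1) (fun=> g2)
    (cell1_point p') (fun=> 1) (fun=> 1) kp'.
- by split=> [||x]; [exact: is_cell2_point | exact: is_cell2_point | exact: e].
- split=> [||x]; try by apply: is_cell2_point; rewrite gact1.
  by rewrite /vcomp /whiskl /whiskr /= !c1coc1 mulg1 mul1g.
exists (z tt); split; first exact/esym/zM.
- by have := z1 tt; rewrite /vcomp /whiskl mul1g.
- by have := z2 tt; rewrite /vcomp /whiskl mul1g.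
Qed.

Section StandardBicoproduct.
Variables (A1 A2 : cell0).
Local Notation G := (cgrp A1 * cgrp A2)%type.

Definition std_act (g : G) (u : A1 * cgrp A2 + cgrp A1 * A2) :=
  match u with
  | inl xk => inl (g.1 *> xk.1, g.2 * xk.2)
  | inr kx => inr (g.1 * kx.1, g.2 *> kx.2) end.

Lemma std_act1 u : std_act 1 u = u.
Proof. by case: u => -[x k]; rewrite /= gact1 mul1g. Qed.

Lemma std_actM g g' u : std_act (g * g') u = std_act g (std_act g' u).
Proof. by case: u => -[x k]; rewrite /= gactM mulgA. Qed.

(** The bicoproduct of X1/G1 and X2/G2 over the single group G1 * G2: its summands
    are the sets induced from X1 and X2. *)
Definition std_cell0 : cell0 := Cell0 (@GSet G _ std_act std_act1 std_actM).

Lemma std_in1_map g (x : A1) :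
  inl (g *> x, 1) = ((g, 1) : cgrp std_cell0) *> (inl (x, 1) : std_cell0).
Proof. by rewrite /= mul1g. Qed.

Lemma std_in1_coc (x : A1) (g g' : cgrp A1) :
  ((g * g', 1) : cgrp std_cell0) = (g, 1) * (g', 1).
Proof. by congr (_, _); rewrite /= mulg1. Qed.

Definition std_in1 : cell1 A1 std_cell0 :=
  @Cell1 A1 std_cell0 (fun x => inl (x, 1)) (fun _ g => (g, 1)) std_in1_map std_in1_coc.

Lemma std_in2_map g (x : A2) :
  inr (1, g *> x) = ((1, g) : cgrp std_cell0) *> (inr (1, x) : std_cell0).
Proof. by rewrite /= mul1g. Qed.

Lemma std_in2_coc (x : A2) (g g' : cgrp A2) :
  ((1, g * g') : cgrp std_cell0) = (1, g) * (1, g').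
Proof. by congr (_, _); rewrite /= mulg1. Qed.

Definition std_in2 : cell1 A2 std_cell0 :=
  @Cell1 A2 std_cell0 (fun x => inr (1, x)) (fun _ g => (1, g)) std_in2_map std_in2_coc.

Variables (C : cell0) (i1 : cell1 A1 C) (i2 : cell1 A2 C).

Definition std_out_map (u : std_cell0) : C :=
  match u with inl xk => i1 xk.1 | inr kx => i2 kx.2 end.

Definition std_out_coc (u : std_cell0) (g : cgrp std_cell0) : cgrp C :=
  match u with inl xk => c1coc i1 xk.1 g.1 | inr kx => c1coc i2 kx.2 g.2 end.

Lemma std_out_mapE g u : std_out_map (g *> u) = std_out_coc u g *> std_out_map u.
Proof. by case: u => -[x k]; apply: c1mapE. Qed.

Lemma std_out_cocM u g g' :
  std_out_coc u (g * g') = std_out_coc (g' *> u) g * std_out_coc u g'.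
Proof. by case: u => -[x k]; apply: c1cocM. Qed.

Definition std_out : cell1 std_cell0 C := Cell1 std_out_mapE std_out_cocM.

End StandardBicoproduct.

Lemma cell2_whiskl (X Y Z : cell0) (b : cell1 Y Z) (f f' : cell1 X Y) e :
  is_cell2 f f' e -> is_cell2 (b \o1 f) (b \o1 f') (whiskl b f e).
Proof.
case=> eM eC; split=> [x|x g] /=; first by rewrite eM c1mapE.
rewrite /comp_coc -eC eM !c1cocM gactK c1cocV; congr (_ * _ * _).
by rewrite /whiskl c1mapE.
Qed.

(** The functor [i1] is fully faithful, its image is disjoint from that of [i2], and
    the two images meet every isomorphism class. *)
Record is_summand (A1 A2 C : cell0) (i1 : cell1 A1 C) (i2 : cell1 A2 C) : Prop := IsSummand {
  summand_full : forall h x x', h *> i1 x = i1 x' -> exists2 g, x' = g *> x & h = c1coc i1 x g;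
  summand_faithful : forall x g, g *> x = x -> c1coc i1 x g = 1 -> g = 1;
  summand_disjoint : forall h x1 x2, h *> i1 x1 <> i2 x2;
  summand_cover : forall c, (exists h x, c = h *> i1 x) \/ (exists h x, c = h *> i2 x) }.

Lemma bicoproduct_sym (A1 A2 C : cell0) (i1 : cell1 A1 C) (i2 : cell1 A2 C) :
  is_bicoproduct i1 i2 -> is_bicoproduct i2 i1.
Proof.
case=> ex un; split=> [Z f2 f1|Z f2 f1 f x2 x1 f' x2' x1' c2 c1 c2' c1'].
  by have [f [x1 [x2 [c1 c2]]]] := ex Z f1 f2; exists f, x2, x1.
have [eta [e0 e1 e2] e3] := un _ _ _ _ _ _ _ _ _ c1 c2 c1' c2'.
by exists eta => [//|eta' [? ? ?]]; apply: e3.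
Qed.

(** The standard inclusions have these properties.  The universal property gives
    a functor [f] to the standard groupoid, and it makes [b \o1 f] isomorphic to
    the identity for the evident functor [b] back; this reflects the properties. *)
Lemma bicoproduct_summand (A1 A2 C : cell0) (i1 : cell1 A1 C) (i2 : cell1 A2 C) :
  is_bicoproduct i1 i2 -> is_summand i1 i2.
Proof.
case=> ex un.
have [f [x1 [x2 [c1 c2]]]] := ex _ (std_in1 A1 A2) (std_in2 A1 A2).
pose b := std_out i1 i2.
have bc1 : is_cell2 ((b \o1 f) \o1 i1) i1 (whiskl b (f \o1 i1) x1).
  by have [m t] := cell2_whiskl b c1; split=> [x|x g]; [exact: m | exact: t].
have bc2 : is_cell2 ((b \o1 f) \o1 i2) i2 (whiskl b (f \o1 i2) x2).
  by have [m t] := cell2_whiskl b c2; split=> [x|x g]; [exact: m | exact: t].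
have id1 : is_cell2 (cell1_id C \o1 i1) i1 (fun=> 1).
  by split=> x *; rewrite ?gact1 //= mul1g invg1 mulg1.
have id2 : is_cell2 (cell1_id C \o1 i2) i2 (fun=> 1).
  by split=> x *; rewrite ?gact1 //= mul1g invg1 mulg1.
(* eta is an isomorphism from b \o1 f to the identity, compatible with x1. *)
have [eta [[etaM etaC] eta1 _] _] := un _ _ _ _ _ _ _ _ _ bc1 bc2 id1 id2.
case: c1 c2 => [c1M c1C] [c2M c2C].
split.
- move=> h x x' e.
  have etaE y : eta (i1 y) = c1coc b (f (i1 y)) (x1 y).
    by have := eta1 y; rewrite /vcomp mul1g.
  pose F := c1coc f (i1 x) h; pose k := x1 x' * (F * (x1 x)^-1).
  have Fx : F *> f (i1 x) = f (i1 x') by rewrite -c1mapE e.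
  have kE : k *> std_in1 A1 A2 x = std_in1 A1 A2 x'.
    by rewrite !c1M !gactM gactK [F *> _]Fx.
  (* k is a morphism between objects in the first summand, so it comes from G1. *)
  exists k.1; first by case: (kE) => ->.
  transitivity (c1coc b (std_in1 A1 A2 x) k); last by [].
  rewrite c1M -[LHS](etaC (i1 x) h) e !etaE c1cocM gactM gactK [F *> _]Fx.
  by rewrite c1cocM gactK c1cocV mulgA.
- move=> x g gx g1; have := c1C x g; rewrite gx /= /comp_coc g1 c1coc1 mulg1 mulgV.
  by case.
- move=> h y1 y2 e.
  have : std_in2 A1 A2 y2 = (x2 y2 * c1coc f (i1 y1) h * (x1 y1)^-1) *> std_in1 A1 A2 y1.
    rewrite c2M !gactM c1M gactK; congr (_ *> _).
    exact: etrans (congr1 f (esym e)) (c1mapE f h (i1 y1)).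
  by [].
move=> c; have := etaM c; rewrite /=; case: (f c) => [[x k]|[k x]] /= ->.
  by left; exists (eta c), x.
by right; exists (eta c), x.
Qed.

Section Summand.
Variables (A1 A2 C : cell0) (i1 : cell1 A1 C) (i2 : cell1 A2 C).
Hypothesis i12 : is_summand i1 i2.

(** The unit of a left Kan extension along a fully faithful functor is invertible. *)
Lemma burnside_star_plus_same : cancel (burnside_plus i1) (burnside_star i1).
Proof.
elim/burnside_ind=> B; have uL := plus_is_lan i1 B.
rewrite burnside_plusE burnside_starE; apply/esym/iso_classP.
apply: (slice_iso_bij (k := lift_hom uL)) => [b b' [eb eu]|[[x l] xl]].
  have [|g b'g g1] := @lan_full _ _ _ _ _ _ uL 1 b b'; first by rewrite gact1.
  have gx : g *> sproj B b = sproj B b by rewrite -gmapE -b'g.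
  by rewrite b'g (summand_faithful i12 gx (esym g1)) gact1.
have [h [b el]] := lan_surj uL l.
have [|g xg hg] := summand_full i12 (h := h) (x := sproj B b) (x' := x).
  by rewrite [i1 x](eqP xl) -el gmapE (lift_proj uL).
exists (g *> b); apply: val_inj; rewrite /= gmapE -xg; congr (_, _).
by rewrite (lift_act uL) -hg.
Qed.

Lemma burnside_star_plus_diff c : burnside_star i1 (burnside_plus i2 c) = 0%R.
Proof.
elim/burnside_ind: c => B; have uL := plus_is_lan i2 B.
rewrite burnside_plusE burnside_starE -[RHS]/(iso_class (slice_empty A1)); apply/iso_classP.
have no (p : star_obj i1 (plus_obj i2 B)) : False.
  have := eqP (valP p); have [h [b <-]] := lan_surj uL (val p).2.
  rewrite gmapE (lift_proj uL) => e.
  apply: (summand_disjoint i12 (h := h^-1) (x1 := (val p).1) (x2 := sproj B b)).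
  by rewrite e gactK.
by apply: (@slice_isoI _ _ (star_obj i1 (plus_obj i2 B)) (slice_empty A1)
  (fun a => match no a with end) (fun x : void => match x with end)) => [g a|a|a|[]];
  case: (no a).
Qed.

End Summand.

Lemma burnside_plus_star_sum (A1 A2 C : cell0) (i1 : cell1 A1 C) (i2 : cell1 A2 C) c :
    is_summand i1 i2 -> is_summand i2 i1 ->
  (burnside_plus i1 (burnside_star i1 c) + burnside_plus i2 (burnside_star i2 c))%R = c.
Proof.
move=> i12 i21; elim/burnside_ind: c => W.
rewrite !burnside_starE !burnside_plusE iso_class_sum; apply/iso_classP.
have uL1 := plus_is_lan i1 (star_obj i1 W); have uL2 := plus_is_lan i2 (star_obj i2 W).
have [k1 k1E] := lan_univ uL1 (lift_star (slice_hom_id (star_obj i1 W))).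
have [k2 k2E] := lan_univ uL2 (lift_star (slice_hom_id (star_obj i2 W))).
pose S := slice_sum (plus_obj i1 (star_obj i1 W)) (plus_obj i2 (star_obj i2 W)).
pose k (s : S) : W := match s with inl l => k1 l | inr l => k2 l end.
have kA g s : k (g *> s) = g *> k s by case: s => l; apply: gmapE.
have kP s : sproj W (k s) = sproj S s by case: s => l; apply: hom_proj.
have inj (D1 D2 : cell0) (j1 : cell1 D1 C) (j2 : cell1 D2 C) 
      (m : slice_hom (plus_obj j1 (star_obj j1 W)) W) :
    is_summand j1 j2 -> is_lan j1 (@plus_unit _ _ j1 (star_obj j1 W)) ->
    (forall t, m (plus_unit j1 t) = (val t).2) -> injective m.
  move=> j12 uL mE l l'.
  have [h [t <-]] := lan_surj uL l; have [h' [t' <-]] := lan_surj uL l'.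
  rewrite !gmapE !mE => e.
  have e' : (h'^-1 * h) *> (val t).2 = (val t').2 by rewrite gactM e gactK.
  have [|g gx hg] := summand_full j12 (h := h'^-1 * h) (x := (val t).1) (x' := (val t').1).
    by rewrite (eqP (valP t)) (eqP (valP t')) -e' gmapE.
  have -> : t' = g *> t.
    by apply: val_inj; rewrite [LHS]surjective_pairing /= -hg e' -gx.
  by rewrite (lift_act uL) -gactM /= -hg mulKVg.
have dis l1 l2 : k1 l1 <> k2 l2.
  have [h1 [t1 <-]] := lan_surj uL1 l1; have [h2 [t2 <-]] := lan_surj uL2 l2.
  rewrite !gmapE k1E k2E /= => e.
  apply: (summand_disjoint i12 (h := h2^-1 * h1) (x1 := (val t1).1) (x2 := (val t2).1)).
  by rewrite (eqP (valP t1)) (eqP (valP t2)) gactM -gmapE e gmapE gactK.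
apply: (slice_iso_bij (k := mk_slice_hom kA kP)) => [[l|l] [l'|l'] /= e|w].
- by congr inl; apply: (inj _ _ _ _ k1 i12 uL1) e => t; apply: k1E.
- by case: (dis _ _ e).
- by case: (dis _ _ (esym e)).
- by congr inr; apply: (inj _ _ _ _ k2 i21 uL2) e => t; apply: k2E.
have [[h [x xw]]|[h [x xw]]] := summand_cover i12 (sproj W w).
  have e : i1 x == sproj W (h^-1 *> w) by rewrite gmapE xw gactK.
  exists (inl (h *> plus_unit i1 (star_pt e))).
  by rewrite /= gmapE k1E /= gactKV.
have e : i2 x == sproj W (h^-1 *> w) by rewrite gmapE xw gactK.
exists (inr (h *> plus_unit i2 (star_pt e))).
by rewrite /= gmapE k2E /= gactKV.
Qed.

Local Close Scope group_scope.
Local Open Scope ring_scope.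

(** * The maps between Burnside rings *)

Lemma polynomial_ext_additive (A B : nmodType) (phi : A -> B) :
    {morph phi : x y / x + y} -> {morph polynomial_ext phi : u v / u + v}.
Proof.
move=> phiD; have kphiD : {morph (fun a => kappa (phi a)) : x y / x + y}.
  by move=> x y; rewrite phiD kappaD.
have [p pE] := polynomial_extP (pol_additive kphiD).
have p0 : polynomial_ext phi 0 = 0.
  rewrite -kappa0 pE; apply: (addrI (kappa (phi 0))); rewrite -kphiD addr0 addr0 //.
move=> u v; have := p v u 0; rewrite /diff !add0r p0 subr0 => /eqP.
by rewrite subr_eq0 subr_eq => /eqP ->; apply: addrC.
Qed.

Section Omega.
Variables (X Y : cell0) (f : cell1 X Y).

Lemma Omega_star_pol : pol 2 (Omega_star f) /\
  forall c, Omega_star f (kappa c) = kappa (burnside_star f c).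
Proof.
apply: polynomial_extP; apply: pol_additive => c d.
by rewrite burnside_starD kappaD.
Qed.

Lemma Omega_plus_pol : pol 2 (Omega_plus f) /\
  forall c, Omega_plus f (kappa c) = kappa (burnside_plus f c).
Proof.
apply: polynomial_extP; apply: pol_additive => c d.
by rewrite burnside_plusD kappaD.
Qed.

Lemma Omega_bullet_pol : pol #|{: X * cgrp Y}|.+1 (Omega_bullet f) /\
  forall c, Omega_bullet f (kappa c) = kappa (burnside_bullet f c).
Proof. exact/polynomial_extP/burnside_bullet_pol. Qed.

Definition Omega_starE := Omega_star_pol.2.
Definition Omega_plusE := Omega_plus_pol.2.
Definition Omega_bulletE := Omega_bullet_pol.2.

Lemma Omega_starD : {morph Omega_star f : u v / u + v}.
Proof. exact/polynomial_ext_additive/burnside_starD. Qed.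

Lemma Omega_plusD : {morph Omega_plus f : u v / u + v}.
Proof. exact/polynomial_ext_additive/burnside_plusD. Qed.

End Omega.

(** Every identity between polynomial maps on Burnside rings reduces in this way to
    an identity between isomorphism classes. *)
Lemma Omega_eq (X : cell0) (N : zmodType) (F F' : Omega X -> N) m n :
  pol m F -> pol n F' -> (forall c, F (kappa c) = F' (kappa c)) -> F =1 F'.
Proof. exact: pol_K0_inj. Qed.

Lemma pol_id (M : zmodType) : pol 2 (id : M -> M).
Proof. by apply: pol_additive. Qed.

Lemma Omega_plus_star_sum (A1 A2 C : cell0) (i1 : cell1 A1 C) (i2 : cell1 A2 C) u :
    is_bicoproduct i1 i2 ->
  Omega_plus i1 (Omega_star i1 u) + Omega_plus i2 (Omega_star i2 u) = u.
Proof.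
move=> i12; move: u; apply: Omega_eq (pol_additive _) (@pol_id _) _ => [u v|c].
  by rewrite !(Omega_starD, Omega_plusD) addrACA.
rewrite !(Omega_starE, Omega_plusE) -kappaD burnside_plus_star_sum //.
  exact: bicoproduct_summand.
exact/bicoproduct_summand/bicoproduct_sym.
Qed.

(** The axioms shared by the two covariant parts, reduced to isomorphism classes.
    The bicoproduct axiom only concerns restriction; its inverse is built from
    left Kan extensions. *)
Lemma Omega_semi_mackey (dn : forall X Y : cell0, cell1 X Y -> Omega X -> Omega Y)
    (bdn : forall X Y : cell0, cell1 X Y -> burnside X -> burnside Y) :
    (forall X Y (f : cell1 X Y), (exists n, pol n (dn X Y f)) /\
       forall c, dn X Y f (kappa c) = kappa (bdn X Y f c)) ->
    (forall X, bdn X X (cell1_id X) =1 id) ->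
    (forall X Y Z (g : cell1 Y Z) (f : cell1 X Y),
       bdn X Z (g \o1 f)%g =1 bdn Y Z g \o bdn X Y f) ->
    (forall X Y (f f' : cell1 X Y) e, is_cell2 f f' e -> bdn X Y f =1 bdn X Y f') ->
    (forall (A1 A2 B P : cell0) (f1 : cell1 A1 B) (f2 : cell1 A2 B)
       (p1 : cell1 P A1) (p2 : cell1 P A2) kap, is_comma f1 f2 p1 p2 kap ->
       burnside_star f1 \o bdn A2 B f2 =1 bdn P A1 p1 \o burnside_star p2) ->
  is_semi_mackey Omega_star dn.
Proof.
move=> dnP dn_id dn_comp dn_cell2 dn_comma.
have dnE X Y f c : dn X Y f (kappa c) = kappa (bdn X Y f c) := (dnP X Y f).2 c.
split=> [X|X Y Z g f|X Y f f' e fe|X|X Y Z g f|X Y f f' e fe|A1 A2 C i1 i2 i12|].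
- by apply: Omega_eq (Omega_star_pol _).1 (@pol_id _) _ => c; rewrite Omega_starE burnside_star_id.
- apply: Omega_eq (Omega_star_pol _).1 (pol_comp (Omega_star_pol g).1 (Omega_star_pol f).1) _ => c.
  by rewrite /= !Omega_starE burnside_star_comp.
- apply: Omega_eq (Omega_star_pol _).1 (Omega_star_pol _).1 _ => c.
  by rewrite !Omega_starE (burnside_star_cell2 fe).
- have [[n p] _] := dnP _ _ (cell1_id X).
  by apply: Omega_eq p (@pol_id _) _ => c; rewrite dnE dn_id.
- have [[n p] _] := dnP _ _ (g \o1 f)%g; have [[ng pg] _] := dnP _ _ g.
  have [[nf pf] _] := dnP _ _ f.
  by apply: Omega_eq p (pol_comp pf pg) _ => c; rewrite /= !dnE dn_comp.
- have [[n p] _] := dnP _ _ f; have [[n' p'] _] := dnP _ _ f'.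
  by apply: Omega_eq p p' _ => c; rewrite !dnE (dn_cell2 _ _ _ _ _ fe).
- have s12 := bicoproduct_summand i12; have s21 := bicoproduct_summand (bicoproduct_sym i12).
  have same (D1 D2 : cell0) (j1 : cell1 D1 C) (j2 : cell1 D2 C) :
      is_summand j1 j2 -> cancel (Omega_plus j1) (Omega_star j1).
    move=> s; apply: Omega_eq (pol_comp (Omega_plus_pol _).1 (Omega_star_pol _).1) (@pol_id _) _.
    by move=> c; rewrite Omega_plusE Omega_starE (burnside_star_plus_same s).
  have diff (D1 D2 : cell0) (j1 : cell1 D1 C) (j2 : cell1 D2 C) :
      is_summand j1 j2 -> forall u, Omega_star j1 (Omega_plus j2 u) = 0.
    move=> s; apply: Omega_eq (pol_comp (Omega_plus_pol _).1 (Omega_star_pol _).1)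
      (_ : pol 0 (fun=> 0)) _ => // c.
    by rewrite Omega_plusE Omega_starE (burnside_star_plus_diff s) kappa0.
  exists (fun uv => Omega_plus i1 uv.1 + Omega_plus i2 uv.2) => [u|[u v]] /=.
    exact: Omega_plus_star_sum.
  rewrite !Omega_starD (same _ _ _ _ s12) (same _ _ _ _ s21).
  by rewrite (diff _ _ _ _ s12) (diff _ _ _ _ s21) addr0 add0r.
move=> A1 A2 B P f1 f2 p1 p2 kap bp.
have [[n pn] _] := dnP _ _ f2; have [[m pm] _] := dnP _ _ p1.
apply: Omega_eq (pol_comp pn (Omega_star_pol _).1) (pol_comp (Omega_star_pol _).1 pm) _ => c.
by rewrite /= !(Omega_starE, dnE) [burnside_star _ _](dn_comma _ _ _ _ _ _ _ _ _ (bipullback_comma bp)).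
Qed.

Theorem corollary7p12 :
  (is_mackey Omega_star Omega_plus /\ is_semi_mackey Omega_star Omega_bullet) /\
  (forall (G H : finGroupType) (X : gset G) (Y : gset H)
     (f : cell1 (Cell0 X) (Cell0 Y)) (A : slice X),
     Omega_bullet f \o Omega_plus (cell1_of_gmap (sproj A)) =1
     Omega_plus (cell1_of_gmap (sproj (exp_P f A)))
       \o Omega_bullet (exp_cell f A)
       \o Omega_star (cell1_of_gmap (zeta f A))).
Proof.
have plusM : is_semi_mackey Omega_star Omega_plus.
  apply: (Omega_semi_mackey (bdn := burnside_plus)) => [X Y f|||| ].
  - by split; [exists 2; apply: (Omega_plus_pol f).1 | apply: Omega_plusE].
  - exact: burnside_plus_id.
  - exact: burnside_plus_comp.
  - exact: burnside_plus_cell2.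
  - exact: burnside_star_plus_comma.
split; first split; first split=> // X.
- exists +%R, 0; split; last by split; [exact: addrA | exact: addrC | exact: add0r
      | move=> s; exists (- s); apply: addNr].
    move=> C i1 i2 nabla e1 e2 bc c1 c2 u.
    rewrite -[in RHS](Omega_plus_star_sum u bc) Omega_plusD.
    rewrite -[Omega_plus nabla (Omega_plus i1 _)](dn_comp plusM).
    rewrite -[Omega_plus nabla (Omega_plus i2 _)](dn_comp plusM).
    by rewrite (dn_cell2 plusM c1) (dn_cell2 plusM c2) !(dn_id plusM).
  exists 0; apply: (addrI (Omega_plus (cell1_init X) 0)).
  by rewrite -Omega_plusD !addr0.
- apply: (Omega_semi_mackey (bdn := burnside_bullet)) => [Y Z f|||| ].
  - by split; [exists #|{: Y * cgrp Z}|.+1; apply: (Omega_bullet_pol f).1 | apply: Omega_bulletE].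
  - exact: burnside_bullet_id.
  - exact: burnside_bullet_comp.
  - exact: burnside_bullet_cell2.
  - exact: burnside_star_bullet_comma.
move=> G H X Y f A.
apply: Omega_eq (pol_comp (Omega_plus_pol _).1 (Omega_bullet_pol _).1)
  (pol_comp (pol_comp (Omega_star_pol _).1 (Omega_bullet_pol _).1) (Omega_plus_pol _).1) _ => c.
rewrite /= !(Omega_starE, Omega_plusE, Omega_bulletE).
by congr kappa; apply: burnside_exponential.
Qed.
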